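(* Let $n\ge 3$ and let $\vec p$ be a regular parameter vector on $[n]$. Then: (1) $\lambda_{K(\vec p)}=\lambda_*$ if and only if $N(\vec p)\ge 1$. (2) $M(\vec p)=N(\vec p)$ if $N(\vec p)\notin\{n-2,n\}$, and $M(\vec p)=n-1$ if $N(\vec p)\in\{n-2,n\}$.
   Context: A parameter vector is a family $\vec p=(p_{i,j})_{i\ne j,\ i,j\in[n]}$ with $p_{i,j}\in(0,1)$ and $p_{i,j}+p_{j,i}=1$. Write $x\in\mathfrak S_n$ in one-line notation $x=(x_1,\dots,x_n)$, and let $x^{\tau_r}$ be obtained from $x$ by swapping the entries in positions $r,r+1$. For $1\le r\le n-1$ let $E_r$ be the $\mathfrak S_n\times\mathfrak S_n$ matrix with $(E_r)_{x,x}=p_{x_r,x_{r+1}}$, $(E_r)_{x,x^{\tau_r}}=p_{x_{r+1},x_r}$, and all other entries $0$; set $K=K(\vec p)=\frac1{n-1}\sum_{r=1}^{n-1}E_r$ (the transition matrix of Fill's adjacent-transposition chain). The spectrum of $K$ is real and contained in $[0,1]$, and $1$ is a simple eigenvalue. The spectral gap is $\lambda_{K(\vec p)}=1-\beta$, where $\beta$ is the second largest eigenvalue of $K$. Set $\lambda_*=\frac{1-\cos(\pi/n)}{n-1}$. $\vec p$ is regular if $p_{i-1,i}\ge 1/2$ for $2\le i\le n$, $p_{i-1,j}\ge p_{i,j}$ for $2\le i<j\le n$, and $p_{i,j+1}\ge p_{i,j}$ for $1\le i<j\le n-1$. A label $c\in[n]$ is neutral if $p_{c,i}=p_{i,c}=1/2$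 for all $i\ne c$. $N(\vec p)$ is the number of neutral labels and $M(\vec p)$ is the algebraic multiplicity of $1-\lambda_*$ as an eigenvalue of $K(\vec p)$. *)

(* Defs.v *)
From HB Require Import structures.
From mathcomp Require Import all_boot all_order all_algebra all_fingroup.
From mathcomp Require Import all_classical all_reals all_analysis.

Set Implicit Arguments.
Unset Strict Implicit.
Unset Printing Implicit Defensive.

Import Order.TTheory GRing.Theory Num.Theory.

Local Open Scope classical_set_scope.
Local Open Scope ring_scope.

(* Labels and positions are elements of 'I_n, i.e. shifted by one with respect
   to [n] = {1, ..., n}.  A family p is a total function of two labels, but its
   diagonal values p i i are unconstrained and never used. *)

Definition param_vector (R : realType) (n : nat) (p : 'I_n -> 'I_n -> R) : Prop :=
  forall i j : 'I_n, i != j -> 0 < p i j < 1 /\ p i j + p j i = 1.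

Definition regular (R : realType) (n : nat) (p : 'I_n -> 'I_n -> R) : Prop :=
  [/\ forall i' i : 'I_n, i = i'.+1 :> nat -> 1 / 2 <= p i' i,
      forall i' i j : 'I_n, i = i'.+1 :> nat -> (i < j)%N -> p i j <= p i' j
    & forall i j j' : 'I_n, j' = j.+1 :> nat -> (i < j)%N -> p i j <= p i j'].

Fact posr_subproof (n : nat) (r : 'I_n.-1) : (r.+1 < n)%N.
Proof. by rewrite -ltn_predRL. Qed.

(* For r : 'I_n.-1, the adjacent positions r and r + 1. *)
Definition posl (n : nat) (r : 'I_n.-1) : 'I_n := widen_ord (leq_pred n) r.
Definition posr (n : nat) (r : 'I_n.-1) : 'I_n := Ordinal (posr_subproof r).

(* The one-line notation of x : 'S_n is (x 0, ..., x (n - 1)).  Since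
   (s * t)%g i = t (s i) for permutations, this swaps the entries of x in
   positions r and r + 1. *)
Definition adj_swap (n : nat) (r : 'I_n.-1) (x : 'S_n) : 'S_n :=
  (tperm (posl r) (posr r) * x)%g.

(* Matrices indexed by 'S_n are indexed through the enumeration of 'S_n. *)
Definition E_mx (R : realType) (n : nat) (p : 'I_n -> 'I_n -> R)
    (r : 'I_n.-1) : 'M[R]_#|{: 'S_n}| :=
  \matrix_(a, b)
    (let x : 'S_n := enum_val a in
     let y : 'S_n := enum_val b in
     if y == x then p (x (posl r)) (x (posr r))
     else if y == adj_swap r x then p (x (posr r)) (x (posl r))
     else 0).

Definition K_mx (R : realType) (n : nat) (p : 'I_n -> 'I_n -> R) :
    'M[R]_#|{: 'S_n}| :=
  (n.-1%:R)^-1 *: \sum_(r < n.-1) E_mx p r.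

(* The supremum, attained when the set is nonempty, of the eigenvalues that are
   not the largest one.  As the top eigenvalue 1 of K is simple, it does not
   matter for K whether eigenvalues are counted with multiplicity. *)
Definition second_largest_eigenvalue (R : realType) (m : nat) (A : 'M[R]_m) : R :=
  sup [set b : R | eigenvalue A b /\ exists2 a, eigenvalue A a & b < a].

Definition spectral_gap (R : realType) (m : nat) (A : 'M[R]_m) : R :=
  1 - second_largest_eigenvalue A.

Definition lambda_star (R : realType) (n : nat) : R :=
  (1 - cos (pi / n%:R)) / n.-1%:R.

Definition neutral (R : realType) (n : nat) (p : 'I_n -> 'I_n -> R) (c : 'I_n) : bool :=
  [forall i : 'I_n, (i != c) ==> (p c i == 1 / 2) && (p i c == 1 / 2)].

Definition num_neutral (R : realType) (n : nat) (p : 'I_n -> 'I_n -> R) : nat :=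
  #|[set c : 'I_n | neutral p c]%SET|.

(* Algebraic multiplicity of a as an eigenvalue of A. *)
Definition alg_mult (R : realType) (m : nat) (A : 'M[R]_m) (a : R) : nat :=
  mup a (char_poly A).

(* Main.v *)
Require Import Defs.
From HB Require Import structures.
From mathcomp Require Import all_boot all_order all_algebra all_fingroup.
From mathcomp Require Import all_classical all_reals all_analysis.
From mathcomp Require Import ring lra zify.

(* Up to the factor n - 1 and the change K = 1 - L / (n - 1), one studies
   L = sum_r P_r with P_r = 1 - E_r; each P_r is an orthogonal projection for
   the weight w(x) = prod_{i < j} p(x_i, x_j).  On the six arrangements of three
   labels in positions r, r+1, r+2 the ranges of P_r and P_{r+1} share one line
   and otherwise meet at a constant angle whose squared cosine is
   (1 + d) / 4, where d <= 0 by regularity and d = 0 only if the middle label is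
   neutral among the three.  Hence <P_r f, P_{r+1} f> >= - |P_r f| |P_{r+1} f| / 2,
   while <P_r f, P_s f> >= 0 for commuting projections, and the Perron vector
   sin(pi r / n) of the path turns this into |L f|^2 >= (1 - cos(pi / n)) <f, L f>.

   If L f = (1 - cos(pi / n)) f, all these inequalities are equalities.  Then P_1 f
   determines f, the increment of f under the swap of the first two entries is a
   function D(x_1, x_2), D is an additive cocycle on labels, and D vanishes on
   every pair lying in a triple with d < 0.  So f is determined by the numbers
   D(1, c), which are zero for non-neutral c unless N is n - 2 or n.  Conversely each
   neutral label c yields the eigenfunction cos(pi (k - 1/2) / n), k being the
   position of c, and for N = n - 2 there is one more eigenfunction involving the
   positions of the two extreme labels. *)

Set Implicit Arguments.
Unset Strict Implicit.
Unset Printing Implicit Defensive.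

Import Order.TTheory GRing.Theory Num.Theory.

Local Open Scope ring_scope.

(** * Algebraic multiplicity of a semisimple eigenvalue *)

Section Matrices.
Variable F : fieldType.

Lemma char_poly_tr m (A : 'M[F]_m) : char_poly A^T = char_poly A.
Proof.
rewrite /char_poly -(det_tr (char_poly_mx A)); congr (\det _).
by apply/matrixP=> i j; rewrite !mxE eq_sym.
Qed.

Lemma char_poly_block_diag m1 m2 (A : 'M[F]_m1) (D : 'M[F]_m2) :
  char_poly (block_mx A 0 0 D) = char_poly A * char_poly D.
Proof.
by rewrite /char_poly char_block_diag_mx det_ublock.
Qed.

Lemma char_poly_scalar m (a : F) : char_poly (a%:M : 'M[F]_m) = ('X - a%:P) ^+ m.
Proof.
rewrite /char_poly -det_scalar; congr (\det _).
by apply/matrixP=> i j; rewrite !mxE polyCMn mulrnBl.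
Qed.

Lemma char_poly_sim m (P A B : 'M[F]_m) :
  P \in unitmx -> P *m A = B *m P -> char_poly A = char_poly B.
Proof.
move=> Pu PA.
have : map_mx polyC P *m char_poly_mx A = char_poly_mx B *m map_mx polyC P.
  rewrite /char_poly_mx mulmxBr mulmxBl -!map_mxM PA.
  by rewrite scalar_mxC.
move=> /(congr1 determinant); rewrite !det_mulmx mulrC => /mulIf; apply.
by rewrite det_map_mx polyC_eq0; move: Pu; rewrite unitmxE unitfE.
Qed.

Lemma mup_char_poly_split m m1 m2 (A : 'M[F]_m) (a : F) (X : 'M[F]_(m1 + m2, m))
    (D : 'M[F]_m2) :
  (m1 + m2 = m)%N -> row_free X -> X *m A = block_mx a%:M 0 0 D *m X ->
  ~~ root (char_poly D) a -> mup a (char_poly A) = m1.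
Proof.
move=> Em; subst m; rewrite row_free_unit => Xu XA rootD.
by rewrite (char_poly_sim Xu XA) char_poly_block_diag char_poly_scalar mupMl //
  mup_XsubCX eqxx.
Qed.

(* A acts as [a] on its eigenspace and without eigenvalue [a] on the image of
   A - a, and the hypothesis makes the two complementary. *)
Lemma mup_char_poly_rank m (A : 'M[F]_m) (a : F) :
  (forall v : 'rV[F]_m, v *m (A - a%:M) *m (A - a%:M) = 0 -> v *m (A - a%:M) = 0) ->
  mup a (char_poly A) = \rank (eigenspace A a).
Proof.
move=> ss; set B := A - a%:M.
set U := row_base (eigenspace A a); set W := row_base B.
have UB : U *m B = 0.
  by apply/sub_kermxP; rewrite /U eq_row_base.
have UA : U *m A = a *: U.
  by apply/eqP; rewrite -subr_eq0 -mul_mx_scalar -mulmxBr UB.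
have [D WA] : exists D, W *m A = D *m W.
  apply/submxP; rewrite /W eq_row_base.
  have -> : A = B + a%:M by rewrite subrK.
  rewrite mulmxDr mul_mx_scalar addmx_sub ?submxMl // scalemx_sub //.
  by rewrite eq_row_base.
(* A common vector is killed by [B] and equals some [w *m B], so [w] is killed by the square of [B]
   and the hypothesis gives [w *m B = 0]. *)
have cap v : (v <= U)%MS -> (v <= W)%MS -> v = 0 :> 'rV[F]_m.
  move=> /submxP[u vu]; rewrite /W eq_row_base => /submxP[w vw].
  by rewrite vw; apply: ss; rewrite -vw vu -mulmxA UB mulmx0.
have rk : (\rank (eigenspace A a) + \rank B = m)%N.
  by rewrite mxrank_ker subnK // rank_leq_row.
have UW : row_free (col_mx U W).
  apply: inj_row_free => v; rewrite -[v]hsubmxK mul_row_col => vUW.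
  have v1 : lsubmx v *m U = 0.
    apply: cap; first exact: submxMl.
    move/eqP: vUW; rewrite addr_eq0 => /eqP ->.
    by rewrite -mulNmx submxMl.
  have v2 : rsubmx v *m W = 0 by move: vUW; rewrite v1 add0r.
  have /eqP -> : lsubmx v == 0.
    by rewrite -(mulmx_free_eq0 _ (row_base_free (eigenspace A a))) v1.
  have /eqP -> : rsubmx v == 0.
    by rewrite -(mulmx_free_eq0 _ (row_base_free B)) v2.
  by rewrite row_mx0.
(* An eigenvector of [D] for [a], multiplied by [W], would lie both in the eigenspace and in the
   image of [B]. *)
have noa : ~~ root (char_poly D) a.
  rewrite -eigenvalue_root_char; apply/negP => /eigenvalueP[w wD w0].
  move/negP: w0; apply; rewrite -(mulmx_free_eq0 _ (row_base_free B)).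
  apply/eqP/cap; last exact: submxMl.
  rewrite /U eq_row_base; apply/eigenspaceP.
  by rewrite -mulmxA WA mulmxA wD scalemxAl.
have XA : col_mx U W *m A = block_mx a%:M 0 0 D *m col_mx U W.
  by rewrite mul_col_mx mul_block_col !mul0mx addr0 add0r mul_scalar_mx UA WA.
exact: mup_char_poly_split rk UW XA noa.
Qed.

End Matrices.

(** * Swap projections *)

Section Operators.
Variables (R : realFieldType) (n : nat) (p : 'I_n -> 'I_n -> R).
Hypothesis hp :
  forall i j : 'I_n, i != j -> 0 < p i j < 1 /\ p i j + p j i = 1.
Implicit Types (i j k l : 'I_n) (x y : 'S_n) (f g h : 'S_n -> R).

Lemma p_gt0 i j : i != j -> 0 < p i j.
Proof. by case/hp => /andP[]. Qed.

Lemma p_sym i j : i != j -> p j i = 1 - p i j.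
Proof. by case/hp => _ <-; rewrite addrC addKr. Qed.

Lemma perm_neq x i j : i != j -> x i != x j.
Proof. by rewrite (inj_eq perm_inj). Qed.

(* For adjacent positions this is 1 - E_r. *)
Definition swap_proj i j f x : R :=
  p (x j) (x i) * (f x - f (tperm i j * x)%g).

Lemma tperm_mulK i j x : (tperm i j * (tperm i j * x))%g = x.
Proof. by rewrite mulgA tperm2 mul1g. Qed.

Lemma tperm_braid i j k x : i != j -> j != k -> i != k ->
  (tperm i j * (tperm j k * (tperm i j * x)) =
   tperm j k * (tperm i j * (tperm j k * x)))%g.
Proof.
move=> ij jk ik; have e1 : (tperm i j * tperm j k * tperm i j)%g = tperm i k.
  by rewrite -{1}[tperm i j]tpermV -mulgA -conjgE tpermJ tpermR tpermD.
have e2 : (tperm j k * tperm i j * tperm j k)%g = tperm i k.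
  rewrite -{1}[tperm j k]tpermV -mulgA -conjgE tpermJ tpermL tpermD //.
  all: try by rewrite eq_sym.
by rewrite !mulgA e1 e2.
Qed.

Lemma tperm_comm i j k l x : i != k -> i != l -> j != k -> j != l ->
  (tperm i j * (tperm k l * x) = tperm k l * (tperm i j * x))%g.
Proof.
by move=> ik il jk jl; rewrite !mulgA [(tperm k l * tperm i j)%g]conjgC tpermJ !tpermD.
Qed.

Lemma swap_proj_idem i j f : i != j ->
  swap_proj i j (swap_proj i j f) = swap_proj i j f.
Proof.
move=> ij; apply/funext=> x; rewrite /swap_proj tperm_mulK !permM tpermL tpermR.
rewrite (p_sym (perm_neq x ij)); ring.
Qed.

Lemma swap_proj_comm i j k l f : i != k -> i != l -> j != k -> j != l ->
  swap_proj i j (swap_proj k l f) = swap_proj k l (swap_proj i j f).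
Proof.
move=> ik il jk jl; apply/funext=> x; rewrite /swap_proj !permM.
rewrite !tpermD //; try by rewrite eq_sym.
rewrite (tperm_comm x ik il jk jl); ring.
Qed.

Lemma swap_projM i j g f : (forall x, g (tperm i j * x)%g = g x) ->
  swap_proj i j (fun x => g x * f x) = fun x => g x * swap_proj i j f x.
Proof. by move=> gE; apply/funext=> x; rewrite /swap_proj gE; ring. Qed.

Lemma swap_projZ i j (a : R) f :
  swap_proj i j (fun x => a * f x) = fun x => a * swap_proj i j f x.
Proof. exact: (@swap_projM i j (fun=> a)). Qed.

Lemma swap_projB i j f g :
  swap_proj i j (fun x => f x - g x) =
  fun x => swap_proj i j f x - swap_proj i j g x.
Proof. by apply/funext=> x; rewrite /swap_proj; ring. Qed.

(** Second elementary symmetric function of the biases [2 * p - 1] along the cycle a, b, c.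
    Reversing the cycle negates all three biases, so for distinct labels the value depends only on
    the set of labels. *)
Definition defect a b c : R :=
  (2 * p a b - 1) * (2 * p b c - 1) + (2 * p b c - 1) * (2 * p c a - 1) +
  (2 * p c a - 1) * (2 * p a b - 1).

(* The squared cosine of the angle between the ranges of two consecutive
   projections, off their intersection, on the arrangements of {a, b, c}. *)
Definition cos2 a b c : R := (1 + defect a b c) / 4.

(** The six rearrangements of the entries at [i], [j], [k], each with the sign of its
    permutation. *)
Definition alt_sum i j k f x : R :=
  f x - f (tperm i j * x)%g + f (tperm j k * (tperm i j * x))%g
  - f (tperm j k * (tperm i j * (tperm j k * x)))%g
  + f (tperm i j * (tperm j k * x))%g - f (tperm j k * x)%g.

(** Up to sign, the function on the six rearrangements that both projections fix: swapping [i] and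
    [j] multiplies it by [p (x i) (x j) / p (x j) (x i)], and similarly for [j] and [k]. *)
Definition inv_weight i j k x : R :=
  p (x j) (x i) * p (x k) (x i) * p (x k) (x j).

Section Triple.
Variables (i j k : 'I_n).
Hypotheses (ij : i != j) (jk : j != k) (ik : i != k).
Local Notation A := (swap_proj i j).
Local Notation B := (swap_proj j k).
Local Notation c2 := (fun x : 'S_n => cos2 (x i) (x j) (x k)).

Let ji : j != i. Proof. by rewrite eq_sym. Qed.
Let ki : k != i. Proof. by rewrite eq_sym. Qed.
Let valE := (permM, tpermL, tpermR, tpermD ik jk, tpermD ji ki).

(** A deformed braid relation: the same [alt_sum] term appears for [A B A] and [B A B]. It lies in
    both ranges, and apart from it [A B A] is just [c2] times [A]. *)
Lemma swap_proj_braidl f :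
  A (B (A f)) = fun x => c2 x * A f x + inv_weight i j k x * alt_sum i j k f x.
Proof.
apply/funext=> x; rewrite /swap_proj /cos2 /inv_weight /alt_sum /defect.
rewrite !valE !tperm_mulK !(tperm_braid _ ij jk ik) ?tperm_mulK.
rewrite (p_sym (perm_neq x ij)) (p_sym (perm_neq x jk)) (p_sym (perm_neq x ik)).
by field.
Qed.

Lemma swap_proj_braidr f :
  B (A (B f)) = fun x => c2 x * B f x + inv_weight i j k x * alt_sum i j k f x.
Proof.
apply/funext=> x; rewrite /swap_proj /cos2 /inv_weight /alt_sum /defect.
rewrite !valE !tperm_mulK.
rewrite (p_sym (perm_neq x ij)) (p_sym (perm_neq x jk)) (p_sym (perm_neq x ik)).
by field.
Qed.

(** Together with [defect_swapr] this makes [cos2] constant on the six rearrangements, so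
    multiplication by it commutes with both projections. *)
Lemma defect_swapl x :
  defect ((tperm i j * x)%g i) ((tperm i j * x)%g j) ((tperm i j * x)%g k)
  = defect (x i) (x j) (x k).
Proof.
rewrite !valE /defect.
rewrite (p_sym (perm_neq x ij)) (p_sym (perm_neq x jk)) (p_sym (perm_neq x ik)).
ring.
Qed.

Lemma defect_swapr x :
  defect ((tperm j k * x)%g i) ((tperm j k * x)%g j) ((tperm j k * x)%g k)
  = defect (x i) (x j) (x k).
Proof.
rewrite !valE /defect.
rewrite (p_sym (perm_neq x ij)) (p_sym (perm_neq x jk)) (p_sym (perm_neq x ik)).
ring.
Qed.

(* The projection of f to the line common to the two ranges. *)
Definition alt_part f x : R :=
  (1 - c2 x)^-1 * (inv_weight i j k x * alt_sum i j k f x).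

Lemma swap_proj_alt_partl f : A (alt_part f) = alt_part f.
Proof.
rewrite /alt_part swap_projM; last by move=> x; rewrite /cos2 defect_swapl.
apply/funext=> x; congr (_ * _).
rewrite /swap_proj /inv_weight /alt_sum.
rewrite !valE !tperm_mulK !(tperm_braid _ ij jk ik) ?tperm_mulK.
rewrite (p_sym (perm_neq x ij)) (p_sym (perm_neq x jk)) (p_sym (perm_neq x ik)).
ring.
Qed.

Lemma swap_proj_alt_partr f : B (alt_part f) = alt_part f.
Proof.
rewrite /alt_part swap_projM; last by move=> x; rewrite /cos2 defect_swapr.
apply/funext=> x; congr (_ * _).
rewrite /swap_proj /inv_weight /alt_sum.
rewrite !valE !tperm_mulK.
rewrite (p_sym (perm_neq x ij)) (p_sym (perm_neq x jk)) (p_sym (perm_neq x ik)).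
ring.
Qed.

End Triple.
End Operators.

(** * The reversible inner product *)

Section InnerProduct.
Variables (R : realFieldType) (n : nat) (p : 'I_n -> 'I_n -> R).
Hypothesis hp :
  forall i j : 'I_n, i != j -> 0 < p i j < 1 /\ p i j + p j i = 1.
Implicit Types (i j k l : 'I_n) (x y : 'S_n) (f g h : 'S_n -> R).
Local Notation P := (swap_proj p).

(* The unnormalised reversible measure of the chain. *)
Definition weight x : R :=
  \prod_(a : 'I_n * 'I_n | (a.1 < a.2)%N) p (x a.1) (x a.2).

Lemma weight_gt0 x : 0 < weight x.
Proof.
apply: prodr_gt0 => -[a b] /= ab; apply: (p_gt0 hp); apply: perm_neq.
by rewrite -val_eqE /= ltn_eqF.
Qed.

(** Detailed balance. Since the positions are adjacent, the swap merely permutes the increasing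
    pairs other than [(i, j)], so their factors have the same product. *)
Lemma weight_swap i j x : j = i.+1 :> nat ->
  weight (tperm i j * x)%g * p (x i) (x j) = weight x * p (x j) (x i).
Proof.
move=> ji; rewrite /weight.
rewrite (bigD1 (i, j)) /=; last by rewrite ji.
rewrite [in RHS](bigD1 (i, j)) /=; last by rewrite ji.
rewrite !permM tpermL tpermR.
set u := \prod_(_ | _) _; set v := \prod_(_ | _) _.
suff -> : u = v by ring.
rewrite /u /v {u v}.
have sK : involutive (fun a : 'I_n * 'I_n => (tperm i j a.1, tperm i j a.2)).
  by move=> [a b]; rewrite /= !tpermK.
rewrite (reindex_inj (inv_inj sK)) /=; apply: eq_big => [[a b] | [a b] _] /=.
  rewrite !xpair_eqE -!val_eqE /=.
  case: (tpermP i j a) => [->|->|/eqP + /eqP]; rewrite -?val_eqE /=;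
  case: (tpermP i j b) => [->|->|/eqP + /eqP]; rewrite -?val_eqE /=; lia.
by rewrite !permM !tpermK.
Qed.

Definition dot f g : R := \sum_x weight x * f x * g x.

Lemma dotC f g : dot f g = dot g f.
Proof. by apply: eq_bigr => x _; ring. Qed.

Lemma dotDl f g h : dot (fun x => f x + g x) h = dot f h + dot g h.
Proof. by rewrite -big_split; apply: eq_bigr => x _ /=; ring. Qed.

Lemma dotZl (a : R) f h : dot (fun x => a * f x) h = a * dot f h.
Proof. by rewrite mulr_sumr; apply: eq_bigr => x _; ring. Qed.

Lemma dotBl f g h : dot (fun x => f x - g x) h = dot f h - dot g h.
Proof. by rewrite -sumrB; apply: eq_bigr => x _ /=; ring. Qed.

Lemma dotDr f g h : dot h (fun x => f x + g x) = dot h f + dot h g.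
Proof. by rewrite dotC dotDl !(dotC h). Qed.

Lemma dotZr (a : R) f h : dot h (fun x => a * f x) = a * dot h f.
Proof. by rewrite dotC dotZl (dotC h). Qed.

Lemma dotBr f g h : dot h (fun x => f x - g x) = dot h f - dot h g.
Proof. by rewrite dotC dotBl !(dotC h). Qed.

Lemma dot_suml (I : Type) (r : seq I) (F : I -> 'S_n -> R) h :
  dot (fun x => \sum_(i <- r) F i x) h = \sum_(i <- r) dot (F i) h.
Proof.
rewrite exchange_big; apply: eq_bigr => x _ /=.
by rewrite mulr_sumr mulr_suml.
Qed.

Lemma dot_sumr (I : Type) (r : seq I) (F : I -> 'S_n -> R) h :
  dot h (fun x => \sum_(i <- r) F i x) = \sum_(i <- r) dot h (F i).
Proof. by rewrite dotC dot_suml; apply: eq_bigr => i _; rewrite dotC. Qed.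

Lemma dot_mull g f h : dot (fun x => g x * f x) h = dot f (fun x => g x * h x).
Proof. by apply: eq_bigr => x _; ring. Qed.

Lemma dot_weighted_ge0 g f : (forall x, 0 <= g x) ->
  0 <= dot f (fun x => g x * f x).
Proof.
move=> g0; apply: sumr_ge0 => x _.
have -> : weight x * f x * (g x * f x) = weight x * g x * (f x) ^+ 2 by ring.
by rewrite mulr_ge0 ?sqr_ge0 // mulr_ge0 // ltW // weight_gt0.
Qed.

Lemma dot_weighted_eq0 g f : (forall x, 0 <= g x) ->
  dot f (fun x => g x * f x) = 0 -> forall x, g x * f x = 0.
Proof.
move=> g0 /eqP; rewrite psumr_eq0; last first.
  move=> x _.
  have -> : weight x * f x * (g x * f x) = weight x * g x * (f x) ^+ 2 by ring.
  by rewrite mulr_ge0 ?sqr_ge0 // mulr_ge0 // ltW // weight_gt0.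
move=> /allP gf x; have := gf x (mem_index_enum x); rewrite /= => /eqP.
move/eqP; rewrite -mulrA mulf_eq0 gt_eqF ?weight_gt0 //= => /eqP e.
case: (eqVneq (f x) 0) => [->|f0]; first by rewrite mulr0.
by apply/eqP; move/eqP: e; rewrite mulf_eq0 (negPf f0).
Qed.

Lemma dot_ge0 f : 0 <= dot f f.
Proof.
have -> : dot f f = dot f (fun x => 1 * f x).
  by apply: eq_bigr => x _; rewrite mul1r.
exact: dot_weighted_ge0.
Qed.

Lemma dot_eq0 f : dot f f = 0 -> f = fun=> 0.
Proof.
move=> ff; apply/funext => x.
have ff1 : dot f (fun x => 1 * f x) = 0.
  by rewrite -ff; apply: eq_bigr => y _; rewrite mul1r.
by have := dot_weighted_eq0 (fun=> ler01) ff1 x; rewrite mul1r.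
Qed.

Lemma swap_proj_adj i j f g : j = i.+1 :> nat ->
  dot (P i j f) g = dot f (P i j g).
Proof.
move=> ji; rewrite /dot /swap_proj.
transitivity (\sum_x (weight x * p (x j) (x i) * f x * g x -
                      weight x * p (x j) (x i) * f (tperm i j * x)%g * g x)).
  by apply: eq_bigr => x _; ring.
transitivity (\sum_x (weight x * p (x j) (x i) * f x * g x -
                      weight x * p (x j) (x i) * f x * g (tperm i j * x)%g));
  last by apply: eq_bigr => x _; ring.
rewrite !sumrB; congr (_ - _).
rewrite (reindex_inj (mulgI (tperm i j))) /=; apply: eq_bigr => x _.
by rewrite tperm_mulK -(weight_swap x ji) !permM tpermL tpermR; ring.
Qed.

Lemma swap_proj_norm i j f : j = i.+1 :> nat ->
  dot (P i j f) (P i j f) = dot f (P i j f).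
Proof.
move=> ji; rewrite swap_proj_adj // swap_proj_idem //.
by rewrite -val_eqE /= ji ltn_eqF.
Qed.

(* The product of two commuting projections is positive semidefinite. *)
Lemma swap_proj_comm_dot i j k l f : j = i.+1 :> nat -> l = k.+1 :> nat ->
  i != k -> i != l -> j != k -> j != l ->
  dot (P i j f) (P k l f) = dot (P i j (P k l f)) (P i j (P k l f)).
Proof.
move=> ji lk ik il jk jl.
have kl : k != l by rewrite -val_eqE /= lk ltn_eqF.
rewrite swap_proj_norm // [RHS]swap_proj_adj // [LHS]swap_proj_adj //.
by rewrite -(swap_proj_comm p (P k l f)) // swap_proj_idem.
Qed.

(** Completing the square. With [A], [B] the two projections, the cross term is [A h] against
    [A B h], and by hypothesis the norm of [A B h] is that of [B h] weighted by [cos2]; what remains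
    is [1 - 4 * cos2], which is minus the defect. *)
Lemma pair_form_centered i j k h (t : R) : j = i.+1 :> nat -> k = j.+1 :> nat ->
  0 < t ->
  P j k (P i j (P j k h)) = (fun x => cos2 p (x i) (x j) (x k) * P j k h x) ->
  2 * dot (P i j h) (P j k h) +
    (t * dot (P i j h) (P i j h) + t^-1 * dot (P j k h) (P j k h)) / 2
  = t / 2 * dot (fun x => P i j h x + 2 / t * P i j (P j k h) x)
                (fun x => P i j h x + 2 / t * P i j (P j k h) x)
    + (2 * t)^-1 * dot (P j k h)
                       (fun x => - defect p (x i) (x j) (x k) * P j k h x).
Proof.
move=> ji kj t0 BAB.
have ij : i != j by rewrite -val_eqE /= ji ltn_eqF.
rewrite !(dotDl, dotDr, dotZl, dotZr).
have -> : dot (P i j (P j k h)) (P i j h) = dot (P i j h) (P j k h).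
  by rewrite dotC -swap_proj_adj // swap_proj_idem.
have -> : dot (P i j h) (P i j (P j k h)) = dot (P i j h) (P j k h).
  by rewrite -swap_proj_adj // swap_proj_idem.
have -> : dot (P i j (P j k h)) (P i j (P j k h)) =
    dot (P j k h) (fun x => cos2 p (x i) (x j) (x k) * P j k h x).
  by rewrite swap_proj_norm // -BAB -!swap_proj_adj // (swap_proj_idem hp) //
     -val_eqE /= kj ltn_eqF.
have -> : (fun x => - defect p (x i) (x j) (x k) * P j k h x) =
    (fun x => P j k h x - 4 * (cos2 p (x i) (x j) (x k) * P j k h x)).
  by apply/funext=> x; rewrite /cos2; field.
rewrite dotBr dotZr; field; exact: lt0r_neq0.
Qed.

(** This says that [f - z] is orthogonal to [z]. By the braid relation [z] is a self-adjoint
    expression in the two projections applied to [f]; moved to the other side it acts on [z], which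
    both projections fix, as the identity. The sign of the defect keeps [1 - c2] away from 0. *)
Lemma dot_alt_part i j k f : j = i.+1 :> nat -> k = j.+1 :> nat ->
  (forall x, defect p (x i) (x j) (x k) <= 0) ->
  dot f (alt_part p i j k f) = dot (alt_part p i j k f) (alt_part p i j k f).
Proof.
move=> ji kj defect_le0.
have ij : i != j by rewrite -val_eqE /= ji ltn_eqF.
have jk : j != k by rewrite -val_eqE /= kj ltn_eqF.
have ik : i != k by rewrite -val_eqE /= kj ji ltn_eqF.
set z := alt_part _ _ _ _ _.
pose c2 x := cos2 p (x i) (x j) (x k).
pose rho x := (1 - c2 x)^-1.
have c2E x : c2 x = (1 + defect p (x i) (x j) (x k)) / 4 by [].
have c2N1 x : 1 - c2 x != 0.
  by rewrite c2E; have := defect_le0 x; lra.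
have zE : z = fun x => rho x * (P i j (P j k (P i j f)) x - c2 x * P i j f x).
  by rewrite swap_proj_braidl //; apply/funext=> x; rewrite addrAC subrr add0r.
have Az : P i j z = z by exact: swap_proj_alt_partl.
have Bz : P j k z = z by exact: swap_proj_alt_partr.
have Arho : P i j (fun x => rho x * z x) = fun x => rho x * z x.
  by rewrite swap_projM ?Az // => x; rewrite /rho /c2 /cos2 defect_swapl.
have Brho : P j k (fun x => rho x * z x) = fun x => rho x * z x.
  by rewrite swap_projM ?Bz // => x; rewrite /rho /c2 /cos2 defect_swapr.
rewrite {2}zE dot_mull dotBl.
rewrite !swap_proj_adj // Arho Brho Arho dot_mull.
have Ac2 : P i j (fun x => c2 x * (rho x * z x)) = fun x => c2 x * (rho x * z x).
  by rewrite swap_projM ?Arho // => x; rewrite /c2 /cos2 defect_swapl.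
rewrite swap_proj_adj // Ac2 -dotBr; congr dot; apply/funext=> x.
rewrite /=; transitivity ((1 - c2 x) * rho x * z x); last by ring.
by rewrite divff ?mul1r.
Qed.

(** Weighted form of the bound by half the product of the norms. Splitting off the common part [z]
    gives a positive multiple of its norm plus the centered form, so [F] is a sum of three
    nonnegative terms; each conclusion of the equality case is one of them vanishing. *)
Lemma pair_form i j k f (t : R) : j = i.+1 :> nat -> k = j.+1 :> nat ->
  (forall x, defect p (x i) (x j) (x k) <= 0) -> 0 < t ->
  let F := 2 * dot (P i j f) (P j k f) +
    (t * dot (P i j f) (P i j f) + t^-1 * dot (P j k f) (P j k f)) / 2 in
  0 <= F /\ (F = 0 ->
    [/\ forall x, alt_sum i j k f x = 0,
        forall x, defect p (x i) (x j) (x k) * P j k f x = 0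
      & forall x, P i j f x = - (2 / t) * P i j (P j k f) x]).
Proof.
move=> ji kj defect_le0 t0.
have ij : i != j by rewrite -val_eqE /= ji ltn_eqF.
have jk : j != k by rewrite -val_eqE /= kj ltn_eqF.
have ik : i != k by rewrite -val_eqE /= kj ji ltn_eqF.
set z := alt_part p i j k f; pose h x := f x - z x.
have c2N1 x : 1 - cos2 p (x i) (x j) (x k) != 0.
  by rewrite /cos2; have := defect_le0 x; lra.
have Az : P i j z = z by exact: swap_proj_alt_partl.
have Bz : P j k z = z by exact: swap_proj_alt_partr.
have Ah : P i j h = fun x => P i j f x - z x by rewrite /h swap_projB Az.
have Bh : P j k h = fun x => P j k f x - z x by rewrite /h swap_projB Bz.
have BABh : P j k (P i j (P j k h)) =
    fun x => cos2 p (x i) (x j) (x k) * P j k h x.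
  rewrite Bh !swap_projB Az Bz swap_proj_braidr //; apply/funext=> x.
  by rewrite /z /alt_part; field.
have fz : dot f z = dot z z by exact: dot_alt_part.
have Af_z : dot (P i j f) z = dot z z by rewrite swap_proj_adj // Az.
have Bf_z : dot (P j k f) z = dot z z by rewrite swap_proj_adj // Bz.
have t20 : 0 < t / 2 by lra.
have t2i : 0 < (2 * t)^-1 by rewrite invr_gt0; lra.
have ti : 0 < t^-1 by rewrite invr_gt0.
move=> F.
have FE : F = (2 + (t + t^-1) / 2) * dot z z +
    (2 * dot (P i j h) (P j k h) +
     (t * dot (P i j h) (P i j h) + t^-1 * dot (P j k h) (P j k h)) / 2).
  rewrite Ah Bh !(dotBl, dotBr) !(dotC z) Af_z Bf_z /F.
  by field; exact: lt0r_neq0.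
rewrite (pair_form_centered ji kj t0 BABh) in FE.
set s := (fun x => P i j h x + _) in FE.
have z0 := dot_ge0 z; have s0 := dot_ge0 s.
have m0 x : 0 <= - defect p (x i) (x j) (x k) by rewrite oppr_ge0.
have d0 := dot_weighted_ge0 (P j k h) m0.
have zc0 : 0 < 2 + (t + t^-1) / 2 by lra.
set d := dot _ (fun x => - _ * _) in FE d0.
have [P1 P2 P3] : [/\ 0 <= (2 + (t + t^-1) / 2) * dot z z,
  0 <= t / 2 * dot s s & 0 <= (2 * t)^-1 * d].
  by split; apply: mulr_ge0 => //; exact: ltW.
split; first by rewrite FE; lra.
rewrite FE => F0.
have /eqP : (2 + (t + t^-1) / 2) * dot z z = 0 by lra.
rewrite mulf_eq0 gt_eqF //= => /eqP /dot_eq0 z_eq0.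
have /eqP : t / 2 * dot s s = 0 by lra.
rewrite mulf_eq0 gt_eqF //= => /eqP /dot_eq0 s_eq0.
have /eqP : (2 * t)^-1 * d = 0 by lra.
rewrite mulf_eq0 gt_eqF //= => /eqP /(dot_weighted_eq0 m0) d_eq0.
have hf : h = f by apply/funext=> x; rewrite /h z_eq0 subr0.
split=> x.
- have w0 : inv_weight p i j k x != 0.
    by rewrite lt0r_neq0 // !mulr_gt0 // (p_gt0 hp) // perm_neq // eq_sym.
  have /eqP := congr1 (@^~ x) z_eq0; rewrite /= /z /alt_part mulf_eq0.
  by rewrite invr_eq0 (negPf (c2N1 x)) /= mulf_eq0 (negPf w0) => /eqP.
- by have /eqP := d_eq0 x; rewrite hf mulNr oppr_eq0 => /eqP.
- have /eqP := congr1 (@^~ x) s_eq0; rewrite /= /s hf addr_eq0 => /eqP ->.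
  by rewrite mulNr.
Qed.

End InnerProduct.

(** * The gap inequality and its equality case *)

(** The bound [s.-1] selects the [r] with [r + 1 < s]; the inner sum is empty for [s = 0] and
    [s = 1]. *)
Lemma double_sum_adjacent (R : comPzRingType) (m : nat) (X : nat -> nat -> R) :
  (forall r s, X r s = X s r) ->
  \sum_(0 <= r < m.+1) \sum_(0 <= s < m.+1) X r s =
  \sum_(0 <= r < m.+1) X r r + 2 * \sum_(0 <= r < m) X r r.+1 +
  2 * \sum_(0 <= s < m.+1) \sum_(0 <= r < s.-1) X r s.
Proof.
move=> Xsym; elim: m => [|m IH].
  by rewrite !big_nat1 !big_geq // !mulr0 !addr0.
rewrite big_nat_recr //=.
have -> : \sum_(0 <= r < m.+1) \sum_(0 <= s < m.+2) X r s =
  \sum_(0 <= r < m.+1) \sum_(0 <= s < m.+1) X r s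
  + \sum_(0 <= r < m.+1) X r m.+1.
  by rewrite -big_split /=; apply: eq_bigr => r _; rewrite [LHS]big_nat_recr.
rewrite IH [\sum_(0 <= s < m.+2) X _ _]big_nat_recr //=.
have -> : \sum_(0 <= s < m.+1) X m.+1 s = \sum_(0 <= r < m.+1) X r m.+1.
  by apply: eq_bigr => r _; exact: Xsym.
rewrite [\sum_(0 <= r < m.+2) X r r]big_nat_recr //=.
rewrite [\sum_(0 <= r < m.+1) X r r.+1]big_nat_recr //=.
rewrite [\sum_(0 <= s < m.+2) \sum_(0 <= r < s.-1) X r s]big_nat_recr //=.
rewrite [\sum_(0 <= r < m.+1) X r m.+1]big_nat_recr //=.
ring.
Qed.

(* [sg] is the Perron eigenvector of the path with vertices 1, ..., m + 1,
   extended by 0 at both ends. *)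
Lemma diagonal_sum_perron (R : realFieldType) (m : nat) (sg : nat -> R) (c : R)
    (X : nat -> R) :
  sg 0%N = 0 -> sg m.+2 = 0 -> (forall r, (r < m.+1)%N -> 0 < sg r.+1) ->
  (forall r, sg r + sg r.+2 = 2 * c * sg r.+1) ->
  \sum_(0 <= r < m) (sg r.+2 / sg r.+1 * X r + (sg r.+2 / sg r.+1)^-1 * X r.+1) / 2
  = c * \sum_(0 <= r < m.+1) X r.
Proof.
move=> sg0 sgm sg_gt0 sgE.
rewrite mulr_sumr.
(* The eigenvector equation splits [c] into half the ratios to the right and left neighbours. The
   two end terms vanish with [sg], and a shift by one turns the left ratios into inverse right
   ratios. *)
have -> : \sum_(0 <= r < m.+1) c * X r =
  \sum_(0 <= r < m.+1) (sg r.+2 / sg r.+1 * X r / 2)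
  + \sum_(0 <= r < m.+1) (sg r / sg r.+1 * X r / 2).
  rewrite -big_split /=; apply: eq_big_nat => r /= rm.
  have -> : c = (sg r + sg r.+2) / (2 * sg r.+1).
    by rewrite sgE; field; rewrite lt0r_neq0 // sg_gt0.
  by field; rewrite lt0r_neq0 // sg_gt0.
rewrite big_nat_recr //= sgm !mul0r addr0.
rewrite big_nat_recl //= sg0 !mul0r add0r -big_split /=.
by apply: eq_bigr => r _; rewrite invf_div; ring.
Qed.

Section Energy.
Variables (R : realFieldType) (m : nat) (p : 'I_m.+2 -> 'I_m.+2 -> R).
Hypothesis hp :
  forall i j : 'I_m.+2, i != j -> 0 < p i j < 1 /\ p i j + p j i = 1.
Hypothesis hdefect : forall a b c : 'I_m.+2,
  a != b -> b != c -> a != c -> defect p a b c <= 0.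
Implicit Types (x y : 'S_m.+2) (f g h : 'S_m.+2 -> R).

(** A natural index lets sums over [r] be peeled and shifted; for [r < m.+1] the [inord] values are
    the genuine positions r and r + 1. *)
Definition step_proj (r : nat) f := swap_proj p (inord r) (inord r.+1) f.
Local Notation P := step_proj.
Local Notation dot := (dot p).

Definition laplacian f x : R := \sum_(0 <= r < m.+1) P r f x.

Lemma inord_neq r s : (r < m.+2)%N -> (s < m.+2)%N -> r != s ->
  inord r != inord s :> 'I_m.+2.
Proof. by move=> rm sm rs; rewrite -val_eqE /= !inordK. Qed.

Lemma inordS r : (r < m.+1)%N -> (inord r.+1 : 'I_m.+2) = (inord r : 'I_m.+2).+1 :> nat.
Proof. by move=> rm; rewrite !inordK // ltnW. Qed.

Lemma step_proj_adj r f g : (r < m.+1)%N -> dot (P r f) g = dot f (P r g).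
Proof. by move=> rm; apply: swap_proj_adj; exact: inordS. Qed.

Lemma laplacian_adj f g : dot (laplacian f) g = dot f (laplacian g).
Proof.
rewrite dot_suml dot_sumr; apply: eq_big_nat => r /= rm.
exact: step_proj_adj.
Qed.

Lemma dot_laplacian f :
  dot f (laplacian f) = \sum_(0 <= r < m.+1) dot (P r f) (P r f).
Proof.
rewrite dot_sumr; apply: eq_big_nat => r /= rm.
by rewrite (swap_proj_norm hp) //; exact: inordS.
Qed.

Lemma step_proj_comm r s f : (r.+1 < s)%N -> (s < m.+1)%N ->
  P r (P s f) = P s (P r f).
Proof.
by move=> rs sm; apply: swap_proj_comm; apply: inord_neq; lia.
Qed.

Lemma step_proj_far r s f : (r.+1 < s)%N -> (s < m.+1)%N ->
  dot (P r f) (P s f) = dot (P r (P s f)) (P r (P s f)).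
Proof.
move=> rs sm; apply: (swap_proj_comm_dot hp); try by apply: inord_neq; lia.
all: by apply: inordS; lia.
Qed.

Lemma defect_inord r x : (r.+1 < m.+1)%N ->
  defect p (x (inord r)) (x (inord r.+1)) (x (inord r.+2)) <= 0.
Proof. by move=> rm; apply: hdefect; apply: perm_neq; apply: inord_neq; lia. Qed.

Variables (sg : nat -> R) (gap : R).
Hypotheses (sg0 : sg 0%N = 0) (sgm : sg m.+2 = 0).
Hypothesis sg_gt0 : forall r, (r < m.+1)%N -> 0 < sg r.+1.
Hypothesis sgE : forall r, sg r + sg r.+2 = 2 * (1 - gap) * sg r.+1.

(** Ratios of consecutive Perron entries: with these weights the diagonal terms taken by the forms
    [F] add up to exactly [1 - gap] times the energy. *)
Let t r := sg r.+2 / sg r.+1.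
Let F f r := 2 * dot (P r f) (P r.+1 f) +
  (t r * dot (P r f) (P r f) + (t r)^-1 * dot (P r.+1 f) (P r.+1 f)) / 2.

Let t_gt0 r : (r.+1 < m.+1)%N -> 0 < t r.
Proof. by move=> rm; rewrite divr_gt0 // sg_gt0 // ltnW. Qed.

Lemma energy_decomposition f :
  dot (laplacian f) (laplacian f) - gap * dot f (laplacian f) =
  \sum_(0 <= r < m) F f r +
  2 * \sum_(0 <= s < m.+1) \sum_(0 <= r < s.-1) dot (P r f) (P s f).
Proof.
rewrite dot_laplacian dot_suml.
under eq_bigr do rewrite dot_sumr.
rewrite (double_sum_adjacent _ (fun r s => dotC p (P r f) (P s f))).
rewrite /F big_split /=.
rewrite (diagonal_sum_perron (fun r => dot (P r f) (P r f)) sg0 sgm sg_gt0 sgE).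
rewrite -mulr_sumr; ring.
Qed.

Let F_pair f r : (r.+1 < m.+1)%N -> 0 <= F f r /\ (F f r = 0 ->
    [/\ forall x, alt_sum (inord r) (inord r.+1) (inord r.+2) f x = 0,
        forall x, defect p (x (inord r)) (x (inord r.+1)) (x (inord r.+2)) *
          P r.+1 f x = 0
      & forall x, P r f x = - (2 / t r) * P r (P r.+1 f) x]).
Proof.
move=> rm; apply: (pair_form hp).
- by apply: inordS; lia.
- by apply: inordS; lia.
- by move=> x; exact: defect_inord.
- exact: t_gt0.
Qed.

Let far_ge0 f s : (s < m.+1)%N -> 0 <= \sum_(0 <= r < s.-1) dot (P r f) (P s f).
Proof.
move=> sm; rewrite big_nat; apply: sumr_ge0 => r /= rs.
by rewrite step_proj_far ?(dot_ge0 hp) //; lia.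
Qed.

Lemma energy_ge0 f : gap * dot f (laplacian f) <= dot (laplacian f) (laplacian f).
Proof.
rewrite -subr_ge0 energy_decomposition addr_ge0 // ?mulr_ge0 //.
  rewrite big_nat; apply: sumr_ge0 => r /= rm.
  by case: (F_pair f (r := r)).
by rewrite big_nat; apply: sumr_ge0 => s /= sm; exact: far_ge0.
Qed.

(** On an eigenfunction the energy inequality reads [gap * mu <= mu ^+ 2] times a positive norm. *)
Lemma laplacian_spectrum f mu :
  laplacian f = (fun x => mu * f x) -> f <> (fun=> 0) -> mu = 0 \/ gap <= mu.
Proof.
move=> Lf f0.
have ff : 0 < dot f f.
  by rewrite lt_neqAle dot_ge0 // andbT eq_sym; apply/eqP=> /(dot_eq0 hp).
have mu0 : 0 <= mu.
  rewrite -(pmulr_lge0 _ ff) -dotZr -Lf dot_laplacian.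
  by apply: sumr_ge0 => r _; exact: dot_ge0.
have := energy_ge0 f; rewrite Lf !dotZl !dotZr => le.
move: mu0; rewrite le0r => /orP[/eqP ->|mu0]; [by left|right].
by move: le; rewrite ler_pM2r // mulr_gt0.
Qed.

Section Extremal.
Variable f : 'S_m.+2 -> R.
Hypothesis Lf : laplacian f = fun x => gap * f x.

Let energy0 : \sum_(0 <= r < m) F f r +
  2 * \sum_(0 <= s < m.+1) \sum_(0 <= r < s.-1) dot (P r f) (P s f) = 0.
Proof. by rewrite -energy_decomposition Lf dotZl !dotZr subrr. Qed.

Let sums0 : \sum_(0 <= r < m) F f r = 0 /\
  \sum_(0 <= s < m.+1) \sum_(0 <= r < s.-1) dot (P r f) (P s f) = 0.
Proof.
have : 0 <= \sum_(0 <= r < m) F f r.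
  by rewrite big_nat; apply: sumr_ge0 => r /= rm; case: (F_pair f (r := r)).
have : 0 <= \sum_(0 <= s < m.+1) \sum_(0 <= r < s.-1) dot (P r f) (P s f).
  by rewrite big_nat; apply: sumr_ge0 => s /= sm; exact: far_ge0.
have := energy0; lra.
Qed.

Lemma extremal_pair r : (r.+1 < m.+1)%N ->
    [/\ forall x, alt_sum (inord r) (inord r.+1) (inord r.+2) f x = 0,
        forall x, defect p (x (inord r)) (x (inord r.+1)) (x (inord r.+2)) *
          P r.+1 f x = 0
      & forall x, P r f x = - (2 / t r) * P r (P r.+1 f) x].
Proof.
move=> rm; apply: (F_pair f rm).2.
case: sums0 => /eqP + _; rewrite big_nat psumr_eq0 => [|s /= sm]; last first.
  by case: (F_pair f (r := s)).
move=> /allP /(_ r); rewrite mem_index_iota /= => /(_ rm).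
by rewrite -ltnS rm => /eqP.
Qed.

Lemma extremal_far r s x : (r.+1 < s)%N -> (s < m.+1)%N -> P r (P s f) x = 0.
Proof.
move=> rs sm; case: sums0 => _ /eqP; rewrite big_nat psumr_eq0 => [|k /= km].
  move=> /allP /(_ s); rewrite mem_index_iota /= => /(_ sm).
  rewrite sm big_nat psumr_eq0 => [/allP /(_ r)|k /= km].
    have rs1 : (r < s.-1)%N by lia.
    rewrite mem_index_iota rs1 /= => /(_ isT).
    by rewrite step_proj_far // => /eqP /(dot_eq0 hp) ->.
  by rewrite step_proj_far ?(dot_ge0 hp) //; lia.
exact: far_ge0.
Qed.

(** The equality case kills [P r.+1 f] where the defect is nonzero; this passes to [P r f], a
    multiple of [P r (P r.+1 f)], because the defect is invariant under the swap. *)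
Lemma extremal_defect r x : (r.+1 < m.+1)%N ->
  defect p (x (inord r)) (x (inord r.+1)) (x (inord r.+2)) * P r f x = 0.
Proof.
move=> rm; have [_ dB AAB] := extremal_pair rm.
rewrite AAB mulrCA /P.
have := @swap_projM _ _ p (inord r) (inord r.+1)
  (fun y => defect p (y (inord r)) (y (inord r.+1)) (y (inord r.+2))) (P r.+1 f).
move=> /(_ _)/(congr1 (@^~ x)) /= <-; last first.
  by move=> y; apply: (defect_swapl hp); apply: inord_neq; lia.
by rewrite /swap_proj !dB subrr !mulr0.
Qed.

(** Inverts the third equality condition: since [alt_sum] and the defect terms vanish,
    [P r.+1 (P r (P r.+1 f))] is a quarter of [P r.+1 f]. *)
Lemma extremal_next r x : (r.+1 < m.+1)%N ->
  P r.+1 f x = - (2 * t r) * P r.+1 (P r f) x.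
Proof.
move=> rm; have [f_alt dB AAB] := extremal_pair rm.
have /funext -> := AAB; rewrite /P swap_projZ.
rewrite (swap_proj_braidr hp); try by apply: inord_neq; lia.
rewrite f_alt mulr0 addr0 /cos2 [(1 + _) / 4]mulrC -[X in _ = _ * (_ * X)]mulrA.
have /eqP := dB x; rewrite /P => /eqP dBx.
rewrite [in X in _ = _ * (_ * (_ * X))]mulrDl mul1r dBx addr0.
by field; rewrite lt0r_neq0 // t_gt0.
Qed.

(** By [extremal_next] all [P r f] vanish in turn, and their sum is [gap * f]. *)
Lemma extremal_eq0 : gap != 0 -> (forall x, P 0 f x = 0) -> forall x, f x = 0.
Proof.
move=> gap0 P0.
have Pr r : (r < m.+1)%N -> forall x, P r f x = 0.
  elim: r => [//|r IH] rm x.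
  rewrite extremal_next // [P r.+1 _]/step_proj /swap_proj.
  by rewrite !IH ?subrr ?mulr0 // ltnW.
move=> x; have := congr1 (@^~ x) Lf; rewrite /= /laplacian big_nat big1 => [|r /= rm].
  by move/esym/eqP; rewrite mulf_eq0 (negPf gap0) => /eqP.
exact: Pr.
Qed.

End Extremal.
End Energy.

(** * Increments of extremal eigenfunctions *)

Section AdjacentInvariance.
Variables (m k : nat) (T : Type) (g : 'S_m.+2 -> T).
Hypothesis g_inv : forall s (x : 'S_m.+2), (k <= s)%N -> (s < m.+1)%N ->
  g (tperm (inord s) (inord s.+1) * x)%g = g x.

(** Induction on the distance: [tperm a b] is [tperm a b'] conjugated by the adjacent transposition
    of [b'] and [b], where [b'] precedes [b]. *)
Lemma adjacent_invariant_tperm (a b : 'I_m.+2) (x : 'S_m.+2) :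
  (k <= a)%N -> (a < b)%N -> g (tperm a b * x)%g = g x.
Proof.
move=> ka ab; have [d Ed] : exists d, (b = a + d.+1 :> nat)%N.
  by exists (b - a.+1)%N; lia.
elim: d b x Ed {ab} => [|d IH] b x Eb.
  have bm := ltn_ord b; have -> : b = inord a.+1.
    by apply: val_inj; rewrite /= inordK; lia.
  by rewrite -{1}[a]inord_val g_inv //; lia.
have bm := ltn_ord b.
pose b' : 'I_m.+2 := inord (a + d.+1).
have b'E : b' = (a + d.+1)%N :> nat by rewrite inordK //; lia.
have bE : b = inord b'.+1.
  by apply: val_inj; rewrite /= inordK b'E; lia.
have step y : g (tperm b' b * y)%g = g y.
  by rewrite bE -{1}[b']inord_val; apply: g_inv; rewrite b'E; lia.
have -> : tperm a b = (tperm b' b * tperm a b' * tperm b' b)%g.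
  rewrite -{1}[tperm b' b]tpermV -mulgA -conjgE tpermJ tpermL tpermD //.
    by rewrite -val_eqE /= b'E; lia.
  by rewrite -val_eqE /= Eb; lia.
by rewrite -!mulgA step IH // step.
Qed.

Lemma adjacent_invariant_agree (x y : 'S_m.+2) :
  (forall i : 'I_m.+2, (i < k)%N -> x i = y i) -> g x = g y.
Proof.
move: {2}#|[set i | x i != y i]%SET| (leqnn #|[set i | x i != y i]%SET|) => d.
elim: d x => [|d IH] x.
  rewrite leqn0 cards_eq0 => /eqP xy _; congr g; apply/permP => i.
  apply/eqP/negPn/negP => xyi.
  by move: (finset.in_set0 i); rewrite -xy inE xyi.
move=> dx agree; case: (eqVneq x y) => [-> //|xy].
have [i xyi] : exists i, x i != y i.
  apply/existsP; apply: contraNT xy; rewrite negb_exists => /forallP nxy.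
  by apply/eqP/permP => i; have := nxy i => /negbNE/eqP.
(* The position where [x] holds the entry wanted at [i]; swapping [i] and [j] lowers the number of
   disagreements, and both lie at or beyond [k]. *)
pose j := (x^-1)%g (y i).
have xj : x j = y i by rewrite /j permKV.
have ij : i != j by apply: contra_neq xyi => e; rewrite -xj -e.
have xyj : x j != y j.
  by rewrite xj (inj_eq perm_inj).
have kP l : x l != y l -> (k <= l)%N.
  by rewrite leqNgt; apply: contraNN => /agree ->.
have gE : g (tperm i j * x)%g = g x.
  have [] := ltngtP i j; last by move/val_inj=> /eqP; rewrite (negPf ij).
    by move=> lij; apply: adjacent_invariant_tperm => //; exact: kP.
  by move=> lij; rewrite tpermC; apply: adjacent_invariant_tperm => //; exact: kP.
rewrite -gE; apply: IH.
  rewrite -ltnS; apply: leq_trans dx; apply: proper_card; apply/properP; split.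
    apply/fintype.subsetP => l; rewrite !inE permM.
    case: tpermP => [->|->|//]; last by [].
    by rewrite xj eqxx.
  by exists i; rewrite !inE // permM tpermL xj eqxx.
move=> l lk; rewrite permM tpermD; first exact: agree.
  by apply: contraTneq lk => <-; rewrite -leqNgt; exact: kP.
by apply: contraTneq lk => <-; rewrite -leqNgt; exact: kP.
Qed.

End AdjacentInvariance.

Section Cocycle.
Variables (R : realFieldType) (m : nat) (p : 'I_m.+3 -> 'I_m.+3 -> R).
Hypothesis hp :
  forall i j : 'I_m.+3, i != j -> 0 < p i j < 1 /\ p i j + p j i = 1.
Hypothesis hdefect : forall a b c : 'I_m.+3,
  a != b -> b != c -> a != c -> defect p a b c <= 0.
Variables (sg : nat -> R) (gap : R).
Hypotheses (sg0 : sg 0%N = 0) (sgm : sg m.+3 = 0).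
Hypothesis sg_gt0 : forall r, (r < m.+2)%N -> 0 < sg r.+1.
Hypothesis sgE : forall r, sg r + sg r.+2 = 2 * (1 - gap) * sg r.+1.

Local Notation i0 := (inord 0 : 'I_m.+3).
Local Notation i1 := (inord 1 : 'I_m.+3).
Local Notation i2 := (inord 2 : 'I_m.+3).

(** One arrangement beginning with [a], [b]. For extremal [f] the increment under the first swap
    depends only on these two entries, so the choice is harmless. *)
Definition arrange2 (a b : 'I_m.+3) : 'S_m.+3 :=
  (tperm i0 a * tperm (tperm i0 a i1) b)%g.

Definition arrange3 (a b c : 'I_m.+3) : 'S_m.+3 :=
  (arrange2 a b * tperm (arrange2 a b i2) c)%g.

Let i01 : i0 != i1. Proof. exact: inord_neq. Qed.
Let i12 : i1 != i2. Proof. exact: inord_neq. Qed.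
Let i02 : i0 != i2. Proof. exact: inord_neq. Qed.

Lemma arrange2E a b : a != b -> arrange2 a b i0 = a /\ arrange2 a b i1 = b.
Proof.
move=> ab; rewrite /arrange2 !permM tpermL; split; last by rewrite tpermL.
rewrite [LHS]tpermD //; last by rewrite eq_sym.
rewrite -{2}(tpermL i0 a) (inj_eq perm_inj); by rewrite eq_sym.
Qed.

Lemma arrange3E a b c : a != b -> b != c -> a != c ->
  [/\ arrange3 a b c i0 = a, arrange3 a b c i1 = b & arrange3 a b c i2 = c].
Proof.
move=> ab bc ac; have [e0 e1] := arrange2E ab.
have E i : arrange3 a b c i = tperm (arrange2 a b i2) c (arrange2 a b i).
  by rewrite /arrange3 permM.
rewrite !E e0 e1; split; last by rewrite tpermL.
- rewrite [LHS]tpermD //; last by rewrite eq_sym.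
  by rewrite -{2}e0 (inj_eq perm_inj) eq_sym.
- rewrite [LHS]tpermD //; last by rewrite eq_sym.
  by rewrite -{2}e1 (inj_eq perm_inj) eq_sym.
Qed.

Definition first_diff (f : 'S_m.+3 -> R) a b : R :=
  f (arrange2 a b) - f (tperm i0 i1 * arrange2 a b)%g.

Section Extremal.
Variable f : 'S_m.+3 -> R.
Hypothesis Lf : laplacian p f = fun x => gap * f x.

Let diff x := f x - f (tperm i0 i1 * x)%g.

Let P0E x : step_proj p 0 f x = p (x i1) (x i0) * diff x.
Proof. by []. Qed.

(** The vanishing of [P s (P 0 f)] says that [P 0 f] is invariant under the swap at [s], and its
    factor [p (x i1) (x i0)] is not affected by that swap. *)
Let diff_swap s x : (2 <= s)%N -> (s < m.+2)%N ->
  diff (tperm (inord s) (inord s.+1) * x)%g = diff x.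
Proof.
move=> s2 sm.
have := extremal_far hp hdefect sg0 sgm sg_gt0 sgE Lf x s2 sm.
rewrite step_proj_comm // [step_proj p s _]/step_proj {1}/swap_proj => /eqP.
have si : inord s != inord s.+1 :> 'I_m.+3 by apply: inord_neq; lia.
have /lt0r_neq0/negPf p0 := p_gt0 hp (perm_neq x (i := inord s.+1) (j := inord s)
  ltac:(by rewrite eq_sym)).
rewrite mulf_eq0 p0 /= subr_eq0 !P0E.
have [d0 d1] : tperm (inord s : 'I_m.+3) (inord s.+1) i0 = i0 /\
    tperm (inord s : 'I_m.+3) (inord s.+1) i1 = i1.
  by split; rewrite tpermD //; apply: inord_neq; lia.
rewrite !permM d0 d1 => /eqP e.
by apply/(mulfI _ (esym e))/lt0r_neq0/(p_gt0 hp)/perm_neq; rewrite eq_sym.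
Qed.

Let diffE x : diff x = first_diff f (x i0) (x i1).
Proof.
have [e0 e1] := arrange2E (perm_neq x i01).
apply: (adjacent_invariant_agree (k := 2)) => [s y s2 sm|i i2].
  exact: diff_swap.
have [->|->] : i = i0 \/ i = i1.
  case: i i2 => -[|[|//]] h _; [left|right]; by apply: val_inj; rewrite /= inordK.
- by rewrite e0.
- by rewrite e1.
Qed.

(** The vanishing alternating sum over the first three positions groups into three increments under
    the first swap. *)
Lemma first_diff_cocycle a b c : a != b -> b != c -> a != c ->
  first_diff f a b + first_diff f b c + first_diff f c a = 0.
Proof.
move=> ab bc ac; have [e0 e1 e2] := arrange3E ab bc ac.
move: (arrange3 a b c) e0 e1 e2 => x e0 e1 e2.
have [alt0 _ _] := extremal_pair hp hdefect sg0 sgm sg_gt0 sgE Lf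
  (ltac:(by []) : (1 < m.+2)%N).
rewrite -(alt0 x) /alt_sum.
set s := tperm i0 i1; set t := tperm i1 i2.
have [s0 s1 s2] : [/\ s i0 = i1, s i1 = i0 & s i2 = i2].
  by rewrite /s tpermL tpermR tpermD.
have [t0 t1] : t i0 = i0 /\ t i1 = i2.
  by rewrite /t tpermL tpermD // eq_sym.
transitivity (diff x + diff (t * (s * x))%g + diff (s * (t * x))%g).
  by rewrite !diffE !permM !(s0, s1, s2, t0, t1) e0 e1 e2.
rewrite /diff -/s -/t tperm_mulK -(tperm_braid x i01 i12 i02) -/s -/t.
by ring.
Qed.

Lemma first_diff_defect a b c : a != b -> b != c -> a != c ->
  defect p a b c != 0 -> first_diff f a b = 0.
Proof.
move=> ab bc ac d0; have [e0 e1 e2] := arrange3E ab bc ac.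
have /eqP := extremal_defect hp hdefect sg0 sgm sg_gt0 sgE Lf (arrange3 a b c)
  (ltac:(by []) : (1 < m.+2)%N).
rewrite e0 e1 e2 mulf_eq0 (negPf d0) /= P0E diffE e0 e1 mulf_eq0.
have ba : b != a by rewrite eq_sym.
by rewrite gt_eqF ?(p_gt0 hp) //= => /eqP.
Qed.

(** Antisymmetry and the cocycle relation express every increment through those based at [a]; all
    being zero, [P 0 f] vanishes. *)
Lemma first_diff_eq0 a : gap != 0 ->
  (forall b, b != a -> first_diff f a b = 0) -> f = fun=> 0.
Proof.
move=> gap0 fa; apply/funext.
apply: (extremal_eq0 hp hdefect sg0 sgm sg_gt0 sgE Lf gap0) => x.
rewrite P0E diffE.
suff fd b c : b != c -> first_diff f b c = 0.
  by rewrite fd ?mulr0 // perm_neq.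
have anti b' c' : b' != c' -> first_diff f b' c' = - first_diff f c' b'.
  move=> bc; have [e0 e1] := arrange2E bc.
  have := diffE (tperm i0 i1 * arrange2 b' c')%g.
  have [-> ->] : (tperm i0 i1 * arrange2 b' c')%g i0 = c' /\
      (tperm i0 i1 * arrange2 b' c')%g i1 = b'.
    by rewrite permM tpermL e1 permM tpermR e0.
  move=> <-.
  have -> : first_diff f b' c' = diff (arrange2 b' c') by [].
  by rewrite /diff tperm_mulK opprB.
move=> bc; case: (eqVneq b a) => [ba|ba].
  by rewrite ba fa // -ba eq_sym.
case: (eqVneq c a) => [ca|ca].
  by rewrite anti // ca fa ?oppr0 // -ca.
have := first_diff_cocycle (a := a) (b := b) (c := c).
rewrite eq_sym ba bc eq_sym ca => /(_ isT isT isT).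
by rewrite fa // add0r (anti c a) // fa // oppr0 addr0.
Qed.

End Extremal.
End Cocycle.

(** * Regular vectors *)

Section Regular.
Variables (R : realType) (m : nat) (p : 'I_m.+3 -> 'I_m.+3 -> R).
Hypotheses (hp : param_vector p) (hreg : regular p).
Implicit Types a b c i j : 'I_m.+3.

Lemma regular_monol a b c : (a <= b)%N -> (b < c)%N -> p b c <= p a c.
Proof.
move=> ab bc; have [d Ed] : exists d, (b = a + d :> nat)%N.
  by exists (b - a)%N; lia.
elim: d b Ed bc {ab} => [|d IH] b Eb bc.
  by have -> : b = a by apply: val_inj; rewrite /= Eb addn0.
have bm := ltn_ord b.
have b'E : (inord (a + d) : 'I_m.+3) = (a + d)%N :> nat by rewrite inordK //; lia.
apply: (le_trans _ (IH (inord (a + d)) b'E _)); last by lia.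
by case: hreg => _ h _; apply: h; lia.
Qed.

Lemma regular_monor a b c : (a < b)%N -> (b <= c)%N -> p a b <= p a c.
Proof.
move=> ab bc; have [d Ed] : exists d, (c = b + d :> nat)%N.
  by exists (c - b)%N; lia.
elim: d c Ed {bc} => [|d IH] c Ec.
  by have -> : c = b by apply: val_inj; rewrite /= Ec addn0.
have cm := ltn_ord c.
have c'E : (inord (b + d) : 'I_m.+3) = (b + d)%N :> nat by rewrite inordK //; lia.
apply: (le_trans (IH (inord (b + d)) c'E)).
by case: hreg => _ _ h; apply: h; lia.
Qed.

Lemma regular_ge_half a b : (a < b)%N -> 1 / 2 <= p a b.
Proof.
move=> ab; have bm := ltn_ord b.
have a'E : (inord a.+1 : 'I_m.+3) = a.+1 :> nat by rewrite inordK //; lia.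
apply: (le_trans _ (@regular_monor a (inord a.+1) b _ _)); try lia.
by case: hreg => h _ _; apply: h.
Qed.

Lemma regular_half a b i j : (a <= i)%N -> (i < j)%N -> (j <= b)%N ->
  p a b = 1 / 2 -> p i j = 1 / 2.
Proof.
move=> ai ij jb pab; apply/eqP; rewrite eq_le regular_ge_half // andbT -pab.
apply: (le_trans (regular_monor ij jb)); apply: regular_monol => //; lia.
Qed.

Lemma defect_rot a b c : defect p a b c = defect p b c a.
Proof. by rewrite /defect; ring. Qed.

Lemma defect_swap a b c : a != b -> b != c -> a != c ->
  defect p a b c = defect p b a c.
Proof.
move=> ab bc ac; rewrite /defect.
by rewrite (p_sym hp ab) (p_sym hp bc) (p_sym hp ac); ring.
Qed.

Let ltn_neq a b : (a < b)%N -> a != b.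
Proof. by move=> ab; rewrite -val_eqE /= ltn_eqF. Qed.

Lemma defect_sorted a b c : (a < b)%N -> (b < c)%N ->
  defect p a b c <= 0 /\
  (defect p a b c = 0 -> p a b = 1 / 2 /\ p b c = 1 / 2).
Proof.
move=> ab bc; have ac := ltn_trans ab bc.
have := regular_ge_half ab; have := regular_ge_half bc.
have := regular_monor ab (ltnW bc).
have := regular_monol (ltnW ab) bc.
rewrite /defect (p_sym hp (ltn_neq ac)).
move: (p a b) (p b c) (p a c) => u v z vz uz v0 u0.
(* The defect is -4 times the sum of the three products bounded here. If they all vanish, so does
   [(u - 1 / 2) * (z - 1 / 2)], and [u <= z] forces [u = 1 / 2]; likewise for [v]. *)
have h1 : 0 <= (u - 1 / 2) * (z - v) by apply: mulr_ge0; lra.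
have h2 : 0 <= (v - 1 / 2) * (z - u) by apply: mulr_ge0; lra.
have h3 : 0 <= (v - 1 / 2) * (u - 1 / 2) by apply: mulr_ge0; lra.
split=> [|e]; first by nra.
have hu : (u - 1 / 2) ^+ 2 <= 0 by nra.
have hv : (v - 1 / 2) ^+ 2 <= 0 by nra.
have sq0 (w : R) : w ^+ 2 <= 0 -> w = 0.
  by move=> w0; apply/eqP; rewrite -sqrf_eq0 eq_le w0 sqr_ge0.
by move: (sq0 _ hu) (sq0 _ hv); lra.
Qed.

Lemma defect_le0 a b c : a != b -> b != c -> a != c -> defect p a b c <= 0.
Proof.
move=> ab bc ac.
have [ba cb ca] : [/\ b != a, c != b & c != a] by split; rewrite eq_sym.
have neq i j : i != j -> (i < j)%N \/ (j < i)%N.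
  by rewrite -val_eqE neq_ltn => /orP.
case: (neq _ _ ab) => lab; case: (neq _ _ bc) => lbc; case: (neq _ _ ac) => lac.
- exact: (defect_sorted lab lbc).1.
- lia.
- by rewrite defect_rot defect_swap // defect_rot defect_rot;
    exact: (defect_sorted lac lbc).1.
- by rewrite -defect_rot; exact: (defect_sorted lac lab).1.
- by rewrite defect_swap //; exact: (defect_sorted lab lac).1.
- by rewrite defect_rot; exact: (defect_sorted lbc lac).1.
- lia.
- rewrite defect_rot defect_rot defect_swap // defect_rot.
  exact: (defect_sorted lbc lab).1.
Qed.

Lemma neutralP c : reflect
  (forall i, i != c -> p c i = 1 / 2 /\ p i c = 1 / 2) (neutral p c).
Proof.
apply: (iffP forallP) => h i.
  by move=> ic; move: (h i); rewrite ic /= => /andP[/eqP -> /eqP ->].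
by apply/implyP => /h [-> ->]; rewrite !eqxx.
Qed.

Lemma neutral_mid i : ord0 != i -> i != ord_max ->
  p ord0 i = 1 / 2 -> p i ord_max = 1 / 2 -> neutral p i.
Proof.
move=> i0 im p0 pm; apply/neutralP => j ji.
have [lij|lji] : (i < j)%N \/ (j < i)%N.
  by move: ji; rewrite -val_eqE neq_ltn => /orP[]; [right|left].
- have pij : p i j = 1 / 2 by apply: regular_half pm => //; rewrite -ltnS.
  by rewrite (p_sym hp (ltn_neq lij)) pij; split=> //; lra.
- have pji : p j i = 1 / 2 by apply: regular_half p0.
  by rewrite (p_sym hp (ltn_neq lji)) pji; split=> //; lra.
Qed.

Let max_neq0 : ord0 != ord_max :> 'I_m.+3. Proof. by []. Qed.

Lemma neutral_all : p ord0 ord_max = 1 / 2 -> forall i, neutral p i.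
Proof.
move=> p0m i; apply/neutralP => j ji.
have half a b : (a < b)%N -> p a b = 1 / 2 /\ p b a = 1 / 2.
  move=> ab; have pab : p a b = 1 / 2.
    by apply: regular_half p0m => //; rewrite -ltnS.
  by rewrite (p_sym hp (ltn_neq ab)) pab; split=> //; lra.
by move: ji; rewrite -val_eqE neq_ltn => /orP[/half[]|/half[]].
Qed.

(** A neutral extreme label forces [p ord0 ord_max = 1 / 2], and then regularity makes every label
    neutral. Otherwise the neutral labels lie among the middle ones, either exhausting them or
    missing some [i]. *)
Lemma neutral_trichotomy :
  [\/ (forall i, neutral p i) /\ num_neutral p = m.+3,
      (forall i, neutral p i = (i != ord0) && (i != ord_max)) /\
        num_neutral p = m.+1
    | [/\ num_neutral p <> m.+3, num_neutral p <> m.+1,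
          ~~ neutral p ord0, ~~ neutral p ord_max &
          exists i, [/\ ord0 != i, i != ord_max & ~~ neutral p i]]].
Proof.
case: (eqVneq (p ord0 ord_max) (1 / 2)) => [/neutral_all all_n|p0m].
  constructor 1; split=> //; rewrite /num_neutral.
  by rewrite (eq_card (B := 'I_m.+3)) ?card_ord // => i; rewrite !inE all_n.
have n0 : ~~ neutral p ord0.
  apply/negP => /neutralP /(_ ord_max) /(_ isT) [e _].
  by rewrite e eqxx in p0m.
have nm : ~~ neutral p ord_max.
  apply/negP => /neutralP /(_ ord0) /(_ isT) [_ e].
  by rewrite e eqxx in p0m.
pose ends : {set 'I_m.+3} := [set ord0; ord_max]%SET.
pose neu : {set 'I_m.+3} := [set c | neutral p c]%SET.
have sub : neu \subset (~: ends)%SET.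
  apply/fintype.subsetP => i; rewrite !inE negb_or => ni.
  by apply/andP; split; apply: contraTneq ni => ->.
have card2 : #|(~: ends)%SET| = m.+1.
  have := cardsC ends.
  by rewrite cards2 max_neq0 card_ord => -[].
have [eqN|neqN] := eqVneq neu (~: ends)%SET.
  constructor 2; rewrite /num_neutral -/neu eqN; split=> // i.
  by have := congr1 (fun S : {set 'I_m.+3} => i \in S) eqN; rewrite !inE negb_or.
have ltN : (num_neutral p < m.+1)%N.
  by rewrite -[X in (_ < X)%N]card2 proper_card // finset.properEneq neqN.
constructor 3; split=> //; [lia | lia |].
have : ~~ ((~: ends)%SET \subset neu).
  by apply: contraNN neqN => sub'; rewrite finset.eqEsubset sub.
case/fintype.subsetPn => i; rewrite !inE negb_or => /andP[i0 im] ni.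
by exists i; split=> //; rewrite eq_sym.
Qed.

Section ExtremalFunctions.
Variables (sg : nat -> R) (gap : R).
Hypotheses (sg0 : sg 0%N = 0) (sgm : sg m.+3 = 0).
Hypothesis sg_gt0 : forall r, (r < m.+2)%N -> 0 < sg r.+1.
Hypothesis sgE : forall r, sg r + sg r.+2 = 2 * (1 - gap) * sg r.+1.
Variable f : 'S_m.+3 -> R.
Hypothesis Lf : laplacian p f = fun x => gap * f x.

(** A non-neutral middle label has nonzero defect with the two extremes, which settles a middle [c];
    for [c = ord_max] the third label is a non-neutral middle [i]. *)
Lemma first_diff_non_neutral c :
  num_neutral p <> m.+3 -> num_neutral p <> m.+1 ->
  c != ord0 -> ~~ neutral p c -> first_diff f ord0 c = 0.
Proof.
move=> N1 N2 c0 nc; have [[_ //]|[_ //]|[_ _ n0 nm [i [i0 im ni]]]] := neutral_trichotomy.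
have fdd := @first_diff_defect R _ p hp defect_le0 sg gap sg0 sgm sg_gt0 sgE f Lf.
have defN j : ord0 != j -> j != ord_max -> ~~ neutral p j ->
    defect p ord0 j ord_max != 0.
  move=> j0 jm; apply: contraNneq => e.
  have [] := (@defect_sorted ord0 j ord_max _ _).2 e.
  - by rewrite lt0n eq_sym.
  - by rewrite ltn_neqAle jm -ltnS ltn_ord.
  exact: neutral_mid.
have [->|cm] := eqVneq c ord_max.
  apply: (fdd _ _ i) => //; first by rewrite eq_sym.
  have [mi i0'] : ord_max != i /\ i != ord0 by split; rewrite eq_sym.
  by rewrite defect_rot defect_swap // defect_rot defect_rot defN.
by apply: (fdd _ _ ord_max) => //; rewrite ?defN // eq_sym.
Qed.

End ExtremalFunctions.
End Regular.

(** * Modes of the path *)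

Section PathModes.
Variables (R : realType) (m : nat).

Let theta : R := pi / m.+3%:R.

Definition sine_mode (r : nat) : R := sin (r%:R * theta).

(** Positions count from 0, hence the shift by plus one half. *)
Definition cosine_mode (k : nat) : R := cos ((k%:R + 1 / 2) * theta).

Definition path_gap : R := 1 - cos theta.

Let theta_n : m.+3%:R * theta = pi.
Proof. by rewrite /theta mulrCA divff ?mulr1 // pnatr_eq0. Qed.

Let theta_gt0 : 0 < theta.
Proof. by rewrite divr_gt0 ?pi_gt0. Qed.

Let theta_lt : theta < pi / 2.
Proof. by rewrite ltr_pM2l ?pi_gt0 // ltf_pV2 ?posrE // ltr_nat. Qed.

Lemma sine_mode0 : sine_mode 0 = 0.
Proof. by rewrite /sine_mode mul0r sin0. Qed.

Lemma sine_mode_end : sine_mode m.+3 = 0.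
Proof. by rewrite /sine_mode theta_n sinpi. Qed.

Lemma sine_mode_gt0 r : (r < m.+2)%N -> 0 < sine_mode r.+1.
Proof.
move=> rm; apply: sin_gt0_pi; rewrite mulr_gt0 //= -theta_n.
by rewrite ltr_pM2r // ltr_nat.
Qed.

Lemma sine_modeE r :
  sine_mode r + sine_mode r.+2 = 2 * (1 - path_gap) * sine_mode r.+1.
Proof.
rewrite /sine_mode /path_gap.
have -> : r%:R * theta = r.+1%:R * theta - theta by rewrite -natr1; ring.
have -> : r.+2%:R * theta = r.+1%:R * theta + theta by rewrite -[in LHS]natr1; ring.
rewrite sinB sinD; ring.
Qed.

Lemma cosine_modeE k : cosine_mode k + cosine_mode k.+2 =
  2 * (1 - path_gap) * cosine_mode k.+1.
Proof.
rewrite /cosine_mode /path_gap.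
have -> : (k%:R + 1 / 2) * theta = (k.+1%:R + 1 / 2) * theta - theta.
  by rewrite -natr1; ring.
have -> : (k.+2%:R + 1 / 2) * theta = (k.+1%:R + 1 / 2) * theta + theta.
  by rewrite -[in LHS]natr1; ring.
rewrite cosB cosD; ring.
Qed.

Lemma cosine_mode_start :
  cosine_mode 0 + cosine_mode 1 = 2 * (1 - path_gap) * cosine_mode 0.
Proof.
rewrite /cosine_mode /path_gap.
have -> : (1%:R + 1 / 2) * theta = (0%:R + 1 / 2) * theta + theta.
  by rewrite mulr0n mulr1n; ring.
rewrite cosD.
have e : cos ((0%:R + 1 / 2) * theta) = cos ((0%:R + 1 / 2) * theta - theta).
  by rewrite -cosN mulr0n; congr cos; field.
rewrite cosB in e; lra.
Qed.

Lemma cosine_mode_end : cosine_mode m.+1 + cosine_mode m.+2 =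
  2 * (1 - path_gap) * cosine_mode m.+2.
Proof.
rewrite /cosine_mode /path_gap.
have -> : (m.+1%:R + 1 / 2) * theta = (m.+2%:R + 1 / 2) * theta - theta.
  by rewrite -[in RHS]natr1; ring.
(* The mode is symmetric about the far end: the two angles are pi minus and plus half of [theta]. *)
have e : cos ((m.+2%:R + 1 / 2) * theta) = cos ((m.+2%:R + 1 / 2) * theta + theta).
  have -> : (m.+2%:R + 1 / 2) * theta + theta = pi + theta / 2.
    by rewrite -theta_n -[in RHS]natr1; field.
  have -> : (m.+2%:R + 1 / 2) * theta = pi - theta / 2.
    by rewrite -theta_n -[in RHS]natr1; field.
  by rewrite cosB cosD sinpi; ring.
rewrite cosD in e; rewrite cosB; lra.
Qed.

Lemma path_gap_gt0 : 0 < path_gap.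
Proof.
rewrite subr_gt0 -(cos0 R) ltr_cos // ?in_itv /=.
- by rewrite lexx pi_ge0.
- by rewrite ltW //=; apply: ltW; have := pi_gt0 R; have := theta_lt; lra.
Qed.

Lemma path_gap_lt1 : path_gap < 1.
Proof.
rewrite /path_gap ltrBlDr ltrDl cos_gt0_pihalf //; apply/andP; split=> //.
by have := pi_gt0 R; have := theta_gt0; have := theta_lt; lra.
Qed.

Lemma cosine_mode01 : cosine_mode 0 - cosine_mode 1 != 0.
Proof.
have := cosine_mode_start => e.
have -> : cosine_mode 0 - cosine_mode 1 = 2 * path_gap * cosine_mode 0 by lra.
rewrite !mulf_neq0 ?pnatr_eq0 // ?gt_eqF ?path_gap_gt0 //.
by apply: cos_gt0_pihalf; have := pi_gt0 R; have := theta_gt0; have := theta_lt; lra.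
Qed.

Lemma sum_pick (M k : nat) (G : nat -> R) :
  \sum_(0 <= r < M) G r * (k == r)%:R = (k < M)%:R * G k.
Proof.
elim: M => [|M IH]; first by rewrite big_geq // mul0r.
rewrite big_nat_recr //= IH ltnS [(k <= M)%N]leq_eqVlt.
case: eqP => [->|_]; rewrite ?ltnn /= ?mulr0n ?mulr1n.
  by rewrite mul0r add0r mulr1 mul1r.
by rewrite mulr0 addr0.
Qed.

(* The cosine mode is an eigenvector of the random walk reflected at both
   ends. *)
Lemma reflected_walk_sum (k : nat) : (k < m.+3)%N ->
  \sum_(0 <= r < m.+2) (cosine_mode r - cosine_mode r.+1) / 2 *
    ((k == r)%:R - (k == r.+1)%:R) = path_gap * cosine_mode k.
Proof.
move=> km; under eq_bigr do rewrite mulrBr.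
rewrite big_split /= sum_pick.
rewrite sumrN.
case: k km => [|k] km.
  rewrite [X in _ - X]big1 => [|r _]; last by rewrite mulr0.
  have := cosine_mode_start; rewrite /= mul1r; lra.
under [X in _ - X]eq_bigr do rewrite eqSS.
rewrite (sum_pick _ _ (fun r => (cosine_mode r - cosine_mode r.+1) / 2)).
rewrite ltnS in km; rewrite km mul1r.
move: km; rewrite leq_eqVlt => /orP[/eqP [->]|km].
  rewrite ltnn mul0r; have := cosine_mode_end; lra.
rewrite ltnS in km; rewrite ltnS km mul1r; have := cosine_modeE k; lra.
Qed.

End PathModes.

(** * Explicit eigenfunctions *)

Section Eigenfunctions.
Variables (R : realType) (m : nat) (p : 'I_m.+3 -> 'I_m.+3 -> R).
Hypothesis hp : param_vector p.
Implicit Types (x y : 'S_m.+3) (a b c i j : 'I_m.+3).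

Local Notation phi := (cosine_mode R m).
Local Notation gap := (path_gap R m).
Local Notation i0 := (inord 0 : 'I_m.+3).
Local Notation i1 := (inord 1 : 'I_m.+3).

Definition pos x c : 'I_m.+3 := (x^-1)%g c.

Lemma pos_eq x c i : (pos x c == i) = (x i == c).
Proof. by apply/eqP/eqP => <-; rewrite /pos ?permK ?permKV. Qed.

Lemma pos_neq x a b : a != b -> pos x a != pos x b.
Proof. by rewrite /pos (inj_eq perm_inj). Qed.

Lemma pos_swap i j x c : pos (tperm i j * x)%g c = tperm i j (pos x c).
Proof. by rewrite /pos invMg tpermV permM. Qed.

Definition position_mode c x : R := phi (pos x c).

Definition at_step (r k : nat) : R := (k == r)%:R - (k == r.+1)%:R.

Lemma position_mode_diff c r x : (r < m.+2)%N ->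
  position_mode c x - position_mode c (tperm (inord r) (inord r.+1) * x)%g =
  (phi r - phi r.+1) * at_step r (pos x c).
Proof.
move=> rm; rewrite /position_mode pos_swap /at_step.
have rE : (inord r : 'I_m.+3) = r :> nat by rewrite inordK // ltnW.
have r1E : (inord r.+1 : 'I_m.+3) = r.+1 :> nat by rewrite inordK.
case: tpermP => [->|->|/eqP + /eqP]; rewrite -?val_eqE /= ?rE ?r1E.
- by rewrite eqxx ltn_eqF // subr0 mulr1.
- by rewrite eqxx gtn_eqF // sub0r mulrN1 opprB.
- by move=> /negPf -> /negPf ->; rewrite !subrr mulr0.
Qed.

Lemma at_step_neq0 c r x : (r < m.+2)%N -> at_step r (pos x c) != 0 ->
  x (inord r) = c \/ x (inord r.+1) = c.
Proof.
move=> rm; rewrite /at_step.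
have rE : (inord r : 'I_m.+3) = r :> nat by rewrite inordK // ltnW.
have r1E : (inord r.+1 : 'I_m.+3) = r.+1 :> nat by rewrite inordK.
have [pr|pr] := eqVneq (pos x c) (inord r).
  by left; apply/eqP; rewrite -pos_eq pr.
have [pr1|pr1] := eqVneq (pos x c) (inord r.+1).
  by right; apply/eqP; rewrite -pos_eq pr1.
by move: pr pr1; rewrite -!val_eqE /= rE r1E => /negPf -> /negPf ->; rewrite subrr eqxx.
Qed.

Lemma p_half_pair a b c : neutral p c -> a != b -> a = c \/ b = c -> p b a = 1 / 2.
Proof.
move/neutralP => nc ab [e|e].
  by rewrite -e in nc; case: (nc b); rewrite // eq_sym.
by rewrite -e in nc; case: (nc a).
Qed.

(** The mode changes only if [c] is one of the swapped labels, and then the swap probability is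
    1/2. *)
Lemma neutral_position_step c r x : neutral p c -> (r < m.+2)%N ->
  step_proj p r (position_mode c) x =
  (phi r - phi r.+1) / 2 * at_step r (pos x c).
Proof.
move=> nc rm; rewrite /step_proj /swap_proj position_mode_diff //.
have [->|/(at_step_neq0 rm)] := eqVneq (at_step r (pos x c)) 0.
  by rewrite !mulr0.
have ne : x (inord r) != x (inord r.+1).
  by apply/perm_neq/inord_neq => //; lia.
by move=> e; rewrite (p_half_pair nc ne e); field.
Qed.

Lemma neutral_position_eigen c : neutral p c ->
  laplacian p (position_mode c) = fun x => gap * position_mode c x.
Proof.
move=> nc; apply/funext => x; rewrite /laplacian.
rewrite -(@reflected_walk_sum R m (pos x c) (ltn_ord _)).
by apply: eq_big_nat => r /= rm; rewrite neutral_position_step.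
Qed.

(* The extra eigenfunction when exactly the two extreme labels are not neutral:
   in each of the two orders of these labels it is a multiple of the difference
   of their one-label modes. *)
Definition extremes_mode x : R :=
  (if (pos x ord0 < pos x ord_max)%N then p ord_max ord0 else p ord0 ord_max) *
  (position_mode ord0 x - position_mode ord_max x).

Hypothesis extremes : forall c, neutral p c = (c != ord0) && (c != ord_max).

(** If one extreme label moves, the order of the two is kept, so the prefactor is constant and the
    swap has probability 1/2. If they trade places, the two prefactors add up to 1 and the same
    formula results. *)
Lemma extremes_step r x : (r < m.+2)%N ->
  step_proj p r extremes_mode x =
  (if (pos x ord0 < pos x ord_max)%N then p ord_max ord0 else p ord0 ord_max) *
  ((phi r - phi r.+1) / 2 * at_step r (pos x ord0) -
   (phi r - phi r.+1) / 2 * at_step r (pos x ord_max)).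
Proof.
move=> rm; rewrite /step_proj /swap_proj /extremes_mode /position_mode !pos_swap.
set i := inord r; set j := inord r.+1.
have iE : i = r :> nat by rewrite inordK // ltnW.
have jE : j = r.+1 :> nat by rewrite inordK.
have ij : i != j by apply: inord_neq => //; lia.
have xij : x i != x j by exact: perm_neq.
have p_xij : x i != ord0 -> x i != ord_max -> p (x j) (x i) = 1 / 2.
  move=> x0 xm; have nc : neutral p (x i) by rewrite extremes x0 xm.
  by apply: (p_half_pair nc xij); left.
have p_xji : x j != ord0 -> x j != ord_max -> p (x j) (x i) = 1 / 2.
  move=> x0 xm; have nc : neutral p (x j) by rewrite extremes x0 xm.
  by apply: (p_half_pair nc xij); right.
have uv := pos_neq x (ltac:(by []) : ord0 != ord_max :> 'I_m.+3).
have p01 := p_sym hp (ltac:(by []) : ord0 != ord_max :> 'I_m.+3).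
rewrite -(pos_eq x ord0) -(pos_eq x ord_max) in p_xij.
rewrite -(pos_eq x ord0) -(pos_eq x ord_max) in p_xji.
have xu : x (pos x ord0) = ord0 by rewrite /pos permKV.
have xv : x (pos x ord_max) = ord_max by rewrite /pos permKV.
move: (pos x ord0) (pos x ord_max) uv xu xv p_xij p_xji => u v uv xu xv p_xij p_xji.
rewrite /at_step.
have swap_lt (k l : 'I_m.+3) : k != i -> k != j -> (l == i) || (l == j) ->
    ((tperm i j l < k) = (l < k))%N /\ ((k < tperm i j l) = (k < l))%N.
  move=> ki kj; have k1 : (k : nat) != r by rewrite -iE (inj_eq val_inj).
  have k2 : (k : nat) != r.+1 by rewrite -jE (inj_eq val_inj).
  by case/orP => /eqP ->; rewrite ?tpermL ?tpermR iE jE; split; lia.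
have nat_i (k : 'I_m.+3) : k != i -> ((k : nat) == r) = false.
  by move=> ki; apply/negbTE; rewrite -iE (inj_eq val_inj).
have nat_j (k : 'I_m.+3) : k != j -> ((k : nat) == r.+1) = false.
  by move=> kj; apply/negbTE; rewrite -jE (inj_eq val_inj).
have fix_k (k : 'I_m.+3) : k != i -> k != j -> tperm i j k = k.
  by move=> ki kj; rewrite tpermD // eq_sym.
have ji : j != i by rewrite eq_sym.
have ii : (i == i) || (i == j) by rewrite eqxx.
have jj : (j == i) || (j == j) by rewrite eqxx orbT.
have rr := ltn_eqF (ltnSn r); have rr' := gtn_eqF (ltnSn r).
have [ui|ui] := eqVneq u i; [subst u | have [uj|uj] := eqVneq u j; [subst u|]];
  (have [vi|vi] := eqVneq v i; [subst v | have [vj|vj] := eqVneq v j; [subst v|]]);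
  rewrite ?eqxx // in uv.
- rewrite tpermL tpermR iE jE ltnSn ltnNge leqnSn /= xu xv !eqxx rr rr' p01 /=.
  by rewrite mulr1n mulr0n; field.
- rewrite (fix_k v) // (swap_lt v i vi vj ii).1 tpermL p_xji // iE jE.
  by rewrite eqxx rr nat_i // nat_j //= ?mulr1n ?mulr0n; field.
- rewrite tpermL tpermR iE jE ltnSn ltnNge leqnSn /= xu xv !eqxx rr rr' p01 /=.
  by rewrite mulr1n mulr0n; field.
- rewrite (fix_k v) // (swap_lt v j vi vj jj).1 tpermR p_xij // iE jE.
  by rewrite eqxx rr' nat_i // nat_j //= ?mulr1n ?mulr0n; field.
- rewrite (fix_k u) // (swap_lt u i ui uj ii).2 tpermL p_xji // iE jE.
  by rewrite eqxx rr nat_i // nat_j //= ?mulr1n ?mulr0n; field.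
- rewrite (fix_k u) // (swap_lt u j ui uj jj).2 tpermR p_xij // iE jE.
  by rewrite eqxx rr' nat_i // nat_j //= ?mulr1n ?mulr0n; field.
- by rewrite !fix_k // !nat_i // !nat_j //= ?mulr1n ?mulr0n; field.
Qed.

Lemma extremes_eigen :
  laplacian p extremes_mode = fun x => gap * extremes_mode x.
Proof.
apply/funext => x; rewrite /laplacian.
under eq_big_nat => r /= rm do rewrite extremes_step //.
rewrite -mulr_sumr sumrB !(reflected_walk_sum _ (ltn_ord _)).
by rewrite /extremes_mode /position_mode; ring.
Qed.

Lemma extremes_first_diff :
  first_diff extremes_mode ord0 ord_max = phi 0 - phi 1.
Proof.
rewrite /first_diff.
have [e0 e1] := @arrange2E m ord0 ord_max (ltac:(by [])).
have p01 := p_sym hp (ltac:(by []) : ord0 != ord_max :> 'I_m.+3).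
move: (arrange2 _ _) e0 e1 => x e0 e1.
rewrite /extremes_mode /position_mode !pos_swap.
have /eqP -> : pos x ord0 == i0 by rewrite pos_eq e0.
have /eqP -> : pos x ord_max == i1 by rewrite pos_eq e1.
by rewrite tpermL tpermR !inordK //= p01; ring.
Qed.

End Eigenfunctions.

(** On labels other than [ord0] the increments of these modes form a scalar matrix, which yields
    linear independence. *)
Lemma position_first_diff (R : realType) (m : nat) (b c : 'I_m.+3) :
  c != ord0 -> b != ord0 ->
  first_diff (position_mode R c) ord0 b =
  - (cosine_mode R m 0 - cosine_mode R m 1) * (b == c)%:R.
Proof.
move=> c0 b0; rewrite /first_diff position_mode_diff // /at_step.
have [e0 e1] := @arrange2E m ord0 b (ltac:(by rewrite eq_sym)).
move: (arrange2 _ _) e0 e1 => x e0 e1.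
have E0 : (inord 0 : 'I_m.+3) = 0%N :> nat by rewrite inordK.
have E1 : (inord 1 : 'I_m.+3) = 1%N :> nat by rewrite inordK.
have -> : (pos x c == 0%N :> nat) = false.
  by apply/negbTE; rewrite -E0 (inj_eq val_inj) pos_eq e0 eq_sym.
have -> : (pos x c == 1%N :> nat) = (b == c).
  by rewrite -E1 (inj_eq val_inj) pos_eq e1.
by rewrite sub0r mulrN mulNr.
Qed.

(** * The transition matrix *)

Section TransitionMatrix.
Variables (R : realType) (m : nat) (p : 'I_m.+3 -> 'I_m.+3 -> R).
Hypotheses (hp : param_vector p) (hreg : regular p).

Local Notation V := 'rV[R]_#|{: 'S_m.+3}|.
Local Notation KT := (K_mx p)^T.
Local Notation gap := (path_gap R m).
Local Notation rate := (m.+2%:R : R).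

(* K acts on functions by column vectors; transposing it makes its
   eigenfunctions row eigenvectors. *)
Definition row_fun (v : V) (x : 'S_m.+3) : R := v 0 (enum_rank x).
Definition fun_row (f : 'S_m.+3 -> R) : V := \row_a f (enum_val a).

Lemma fun_rowK f : row_fun (fun_row f) = f.
Proof. by apply/funext=> x; rewrite /row_fun mxE enum_rankK. Qed.

Lemma row_fun_inj : injective row_fun.
Proof.
move=> v w e; apply/rowP => a.
by have := congr1 (@^~ (enum_val a)) e; rewrite /row_fun /= enum_valK.
Qed.

Lemma row_fun0 v : row_fun v = (fun=> 0) -> v = 0.
Proof.
move=> e; apply: row_fun_inj; rewrite e.
by apply/funext=> x; rewrite /row_fun mxE.
Qed.

Let rate_neq0 : rate != 0. Proof. by rewrite pnatr_eq0. Qed.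

Lemma row_fun_mulK v : row_fun (v *m KT) =
  fun x => row_fun v x - rate^-1 * laplacian p (row_fun v) x.
Proof.
apply/funext=> x; rewrite {1}/row_fun mxE.
rewrite (reindex (@enum_rank 'S_m.+3)) /=; last exact/onW_bij/enum_rank_bij.
transitivity (rate^-1 * \sum_(r < m.+2)
  (row_fun v x - step_proj p r (row_fun v) x)); last first.
  rewrite sumrB sumr_const card_ord.
  rewrite -(big_mkord xpredT (fun r => step_proj p r (row_fun v) x)).
  by rewrite mulrBr -[row_fun v x *+ _]mulr_natl mulrA mulVf // mul1r.
rewrite mulr_sumr.
under eq_bigr => y _ do rewrite !mxE summxE mulrCA mulr_sumr mulr_sumr.
rewrite exchange_big /=; apply: eq_bigr => r _.
under eq_bigr => y _ do rewrite mxE !enum_rankK.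
rewrite -mulr_sumr; congr (_ * _).
have rl : @posl m.+3 r = inord r :> 'I_m.+3.
  apply: val_inj; rewrite /= inordK //; exact/leqW/ltn_ord.
have rr : @posr m.+3 r = inord r.+1 :> 'I_m.+3.
  by apply: val_inj; rewrite /= inordK // ltnS ltn_ord.
have lr : @posl m.+3 r != @posr m.+3 r by rewrite -val_eqE /= ltn_eqF.
have swap_neq : @adj_swap m.+3 r x != x.
  rewrite /adj_swap; apply/eqP => /(congr1 (fun s : 'S_m.+3 => s (@posl m.+3 r))).
  by rewrite permM tpermL => /perm_inj /eqP; rewrite eq_sym (negPf lr).
rewrite (bigD1 x) //= eqxx (bigD1 (@adj_swap m.+3 r x)) //= (negPf swap_neq) eqxx.
rewrite big1 => [|y /andP[/negPf -> /negPf ->]]; last by rewrite mulr0.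
rewrite /step_proj /swap_proj -rl -rr addr0 -/(row_fun v _) -/(row_fun v _).
by rewrite (p_sym hp (perm_neq x lr)) /adj_swap; ring.
Qed.

Lemma mulK_eigen v b : v *m KT = b *: v <->
  laplacian p (row_fun v) = fun x => rate * (1 - b) * row_fun v x.
Proof.
have row_funZ : row_fun (b *: v) = fun x => b * row_fun v x.
  by apply/funext=> x; rewrite /row_fun mxE.
split=> [e|e].
  have := congr1 row_fun e; rewrite row_fun_mulK row_funZ => e'.
  apply/funext=> x; have := congr1 (@^~ x) e' => /= e''.
  have -> : rate * (1 - b) * row_fun v x = rate * (row_fun v x - b * row_fun v x).
    by ring.
  by rewrite -e''; field.
apply: row_fun_inj; rewrite row_fun_mulK row_funZ e; apply/funext=> x.
by field.
Qed.

Lemma eigenvalueK b : eigenvalue (K_mx p) b <->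
  exists2 f, laplacian p f = (fun x => rate * (1 - b) * f x) & f <> (fun=> 0).
Proof.
rewrite eigenvalue_root_char -char_poly_tr -eigenvalue_root_char; split.
  case/eigenvalueP => v /mulK_eigen e v0; exists (row_fun v) => // /row_fun0 v0'.
  by rewrite v0' eqxx in v0.
case=> f e f0; apply/eigenvalueP; exists (fun_row f).
  by apply/mulK_eigen; rewrite fun_rowK.
by apply/eqP => f0'; apply: f0; rewrite -[f]fun_rowK f0'; apply/funext=> x;
  rewrite /row_fun mxE.
Qed.

(** Self-adjointness: with [w] the image of [v] under [KT - a], the square norm of [w] is the
    product of [v] with the image of [w], which is 0. *)
Lemma K_semisimple a (v : V) :
  v *m (KT - a%:M) *m (KT - a%:M) = 0 -> v *m (KT - a%:M) = 0.
Proof.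
have row_funM u : row_fun (u *m (KT - a%:M)) =
    fun x => (1 - a) * row_fun u x - rate^-1 * laplacian p (row_fun u) x.
  apply/funext=> x; have := congr1 (@^~ x) (row_fun_mulK u).
  rewrite mulmxBr mul_mx_scalar /row_fun /= => ex.
  transitivity ((u *m KT) 0 (enum_rank x) - a * u 0 (enum_rank x)).
    by rewrite [LHS]mxE; congr (_ + _); rewrite mxE; congr (- _); rewrite mxE.
  by rewrite ex; ring.
set w := v *m _ => w0; apply: row_fun0; apply: (dot_eq0 hp).
rewrite [X in dot _ X _](row_funM v) dotBl !dotZl laplacian_adj -!dotZr -dotBr.
rewrite -(row_funM w) w0.
by apply: big1 => x _; rewrite /row_fun mxE mulr0.
Qed.

End TransitionMatrix.

(** * Multiplicity and spectral gap *)

Section Multiplicity.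
Variables (R : realType) (m : nat) (p : 'I_m.+3 -> 'I_m.+3 -> R).
Hypotheses (hp : param_vector p) (hreg : regular p).

Local Notation N := (num_neutral p).
Local Notation V := 'rV[R]_#|{: 'S_m.+3}|.
Local Notation KT := (K_mx p)^T.
Local Notation gap := (path_gap R m).
Local Notation top := (1 - lambda_star R m.+3).

(* Labels c such that the increments [first_diff f ord0 c] are coordinates on
   the space of extremal eigenfunctions. *)
Definition free_labels : {set 'I_m.+3} :=
  if (N == m.+3) || (N == m.+1) then (~: [set ord0])%SET
  else [set c | neutral p c]%SET.

Lemma card_free_labels :
  #|free_labels| = if (N == m.+3) || (N == m.+1) then m.+2 else N.
Proof.
rewrite /free_labels; case: ifP => // _.
by have := cardsC [set (ord0 : 'I_m.+3)]%SET; rewrite cards1 card_ord => -[].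
Qed.

Lemma free_labelP c : c \in free_labels -> c != ord0 /\
  (neutral p c \/ c = ord_max /\
    forall i, neutral p i = (i != ord0) && (i != ord_max)).
Proof.
rewrite /free_labels.
case: (neutral_trichotomy hp hreg) => [[h e]|[h e]|[/eqP/negPf e1 /eqP/negPf e2 n0 _ _]].
- by rewrite {1}e eqxx /= !inE => c0; split=> //; left.
- rewrite {2}e eqxx orbT !inE => c0; split=> //.
  by have [cm|cm] := eqVneq c ord_max; [right | left; rewrite h c0].
- rewrite e1 e2 !inE => nc; split; last by left.
  by apply: contraTneq nc => ->.
Qed.

Lemma lambda_starE : m.+2%:R * (1 - top) = gap.
Proof.
have -> : 1 - top = lambda_star R m.+3 by ring.
by rewrite /lambda_star mulrCA divff ?mulr1 // pnatr_eq0.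
Qed.

Lemma row_fun_pick (v : V) y :
  \sum_a v 0 a * (y == enum_val a)%:R = row_fun v y.
Proof.
rewrite (bigD1 (enum_rank y)) //= enum_rankK eqxx mulr1 big1 ?addr0 // => a ay.
case: eqP => [e|_]; last by rewrite mulr0.
by rewrite e enum_valK eqxx in ay.
Qed.

Definition diff_mx : 'M[R]_(#|{: 'S_m.+3}|, #|free_labels|) :=
  \matrix_(a, b) first_diff (fun x => (x == enum_val a)%:R) ord0 (enum_val b).

Lemma mul_diff_mx (v : V) b :
  (v *m diff_mx) 0 b = first_diff (row_fun v) ord0 (enum_val b).
Proof.
rewrite mxE; under eq_bigr => a _ do rewrite mxE /first_diff mulrBr.
by rewrite sumrB !row_fun_pick.
Qed.

Lemma eigenspace_row_fun (v : V) : (v <= eigenspace KT top)%MS ->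
  laplacian p (row_fun v) = fun x => gap * row_fun v x.
Proof. by move/eigenspaceP/(mulK_eigen hp); rewrite lambda_starE. Qed.

(** The increments at the free labels are injective on the eigenspace, since those at the remaining
    labels vanish automatically. *)
Lemma rank_eigenspace_le : (\rank (eigenspace KT top) <= #|free_labels|)%N.
Proof.
have gap0 : gap != 0 by rewrite gt_eqF ?path_gap_gt0.
rewrite -(mxrank_mul_ker _ diff_mx).
suff /eqP -> : (eigenspace KT top :&: kermx diff_mx)%MS == 0.
  by rewrite mxrank0 addn0 rank_leq_col.
apply/rowV0P => v; rewrite sub_capmx => /andP[/eigenspace_row_fun Lv /sub_kermxP v0].
apply: row_fun0.
apply: (first_diff_eq0 hp (defect_le0 hp hreg) (sine_mode0 R m) (sine_mode_end R m)
  (@sine_mode_gt0 R m) (@sine_modeE R m) Lv gap0 (a := ord0)) => c c0.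
have [cB|cB] := boolP (c \in free_labels).
  have := mul_diff_mx v (enum_rank_in cB c).
  by rewrite v0 mxE enum_rankK_in.
have : ~~ ((N == m.+3) || (N == m.+1)).
  by apply: contraNN cB => e; rewrite /free_labels e !inE.
rewrite negb_or => /andP[/eqP N1 /eqP N2].
apply: (first_diff_non_neutral hp hreg (sine_mode0 R m) (sine_mode_end R m)
  (@sine_mode_gt0 R m) (@sine_modeE R m) Lv N1 N2 c0).
move: cB; rewrite /free_labels.
by move/eqP/negPf: N1 => ->; move/eqP/negPf: N2 => ->; rewrite inE.
Qed.

Definition mode c : 'S_m.+3 -> R :=
  if neutral p c then position_mode R c else extremes_mode p.

Lemma mode_eigen c : c \in free_labels ->
  laplacian p (mode c) = fun x => gap * mode c x.
Proof.
case/free_labelP => _ [nc|[-> ext]]; rewrite /mode.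
  by rewrite nc; exact: neutral_position_eigen.
by rewrite ext eqxx andbF; exact: extremes_eigen.
Qed.

Definition mode_mx : 'M[R]_(#|free_labels|, #|{: 'S_m.+3}|) :=
  \matrix_b fun_row (mode (enum_val b)).

Lemma mode_mx_diff (u : 'rV[R]_#|free_labels|) b :
  (u *m mode_mx *m diff_mx) 0 b =
  \sum_c u 0 c * first_diff (mode (enum_val c)) ord0 (enum_val b).
Proof.
rewrite -mulmxA mxE; apply: eq_bigr => c _; congr (_ * _).
have -> : (mode_mx *m diff_mx) c b = (row c mode_mx *m diff_mx) 0 b.
  by rewrite -row_mul [RHS]mxE.
by rewrite mul_diff_mx rowK fun_rowK.
Qed.

(** The product with [diff_mx] is triangular: neutral modes have no increment at the other labels,
    so the coefficient of [extremes_mode] vanishes first and the neutral ones follow. *)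
Lemma mode_mx_free : row_free mode_mx.
Proof.
apply: inj_row_free => u u0.
have dphi := cosine_mode01 R m.
have sum0 (b : 'I_#|free_labels|) :
    \sum_c u 0 c * first_diff (mode (enum_val c)) ord0 (enum_val b) = 0.
  by rewrite -mode_mx_diff u0 mul0mx mxE.
have neutral_diff (c b : 'I_#|free_labels|) : neutral p (enum_val c) ->
    first_diff (mode (enum_val c)) ord0 (enum_val b) =
    - (cosine_mode R m 0 - cosine_mode R m 1) * (b == c)%:R.
  move=> nc; rewrite /mode nc position_first_diff ?(inj_eq enum_val_inj) //.
    by case: (free_labelP (enum_valP c)).
  by case: (free_labelP (enum_valP b)).
have u_extreme (c : 'I_#|free_labels|) : ~~ neutral p (enum_val c) -> u 0 c = 0.
  move=> nc; have := sum0 c; rewrite (bigD1 c) //= big1 => [|d dc]; last first.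
    have nd : neutral p (enum_val d).
      case: (free_labelP (enum_valP d)) => _ [//|[dm _]].
      case: (free_labelP (enum_valP c)) => _ [nc'|[cm _]]; first by rewrite nc' in nc.
      by move: dc; rewrite -(inj_eq enum_val_inj) dm cm eqxx.
    by rewrite neutral_diff // eq_sym (negPf dc) !mulr0.
  rewrite addr0 /mode (negPf nc).
  case: (free_labelP (enum_valP c)) => _ [nc'|[-> _]]; first by rewrite nc' in nc.
  by rewrite extremes_first_diff // => /eqP; rewrite mulf_eq0 (negPf dphi) orbF => /eqP.
apply/rowP => c; rewrite [RHS]mxE.
have [nc|/u_extreme //] := boolP (neutral p (enum_val c)).
have := sum0 c; rewrite (bigD1 c) //= big1 => [|d dc]; last first.
  have [nd|/u_extreme ->] := boolP (neutral p (enum_val d)); last by rewrite mul0r.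
  by rewrite neutral_diff // eq_sym (negPf dc) !mulr0.
rewrite addr0 neutral_diff // eqxx mulr1 => /eqP.
by rewrite mulf_eq0 oppr_eq0 (negPf dphi) orbF => /eqP.
Qed.

Lemma alg_mult_top : alg_mult (K_mx p) top = #|free_labels|.
Proof.
rewrite /alg_mult -char_poly_tr mup_char_poly_rank; last exact: K_semisimple.
apply/eqP; rewrite eqn_leq rank_eigenspace_le /=.
have /eqP <- : \rank mode_mx == #|free_labels| by exact: mode_mx_free.
apply/mxrankS/row_subP => b; rewrite rowK.
apply/eigenspaceP/(mulK_eigen hp); rewrite lambda_starE fun_rowK.
exact/mode_eigen/enum_valP.
Qed.

(** In the exceptional cases the multiplicity differs from [N], but both are positive since [N] is
    then at least [m.+1]. *)
Lemma eigenvalue_top : eigenvalue (K_mx p) top = (0 < N)%N.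
Proof.
have nz : char_poly (K_mx p) != 0 by rewrite monic_neq0 ?char_poly_monic.
have -> : eigenvalue (K_mx p) top = (0 < alg_mult (K_mx p) top)%N.
  by rewrite /alg_mult -XsubC_dvd // dvdp_XsubCl eigenvalue_root_char.
rewrite alg_mult_top card_free_labels; case: ifP => // /orP[/eqP e|/eqP e].
  by rewrite {1}e.
by rewrite {1}e.
Qed.

Lemma eigenvalue_le b : eigenvalue (K_mx p) b -> b = 1 \/ b <= top.
Proof.
case/(eigenvalueK hp) => f Lf f0.
have [/eqP|] := laplacian_spectrum hp (defect_le0 hp hreg) (sine_mode0 R m)
  (sine_mode_end R m) (@sine_mode_gt0 R m) (@sine_modeE R m) Lf f0.
  by rewrite mulf_eq0 pnatr_eq0 /= subr_eq0 => /eqP; left.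
by rewrite -lambda_starE ler_pM2l ?ltr0n // => ?; right; lra.
Qed.

Lemma eigenvalue1 : eigenvalue (K_mx p) 1.
Proof.
apply/(eigenvalueK hp); exists (fun=> 1).
  apply/funext=> x; rewrite /laplacian subrr mulr0 mul0r big1 // => r _.
  by rewrite /step_proj /swap_proj subrr mulr0.
move/(congr1 (fun f : 'S_m.+3 -> R => f 1%g)) => /eqP.
by rewrite oner_eq0.
Qed.

Lemma top_bounds : 0 < top < 1.
Proof.
have e := lambda_starE; have g0 := path_gap_gt0 R m; have g1 := path_gap_lt1 R m.
have lE : lambda_star R m.+3 = gap / m.+2%:R by [].
have l0 : 0 < lambda_star R m.+3 by rewrite lE divr_gt0.
have : lambda_star R m.+3 < 1.
  by rewrite lE ltr_pdivrMr ?ltr0n // mul1r (lt_le_trans g1) // ler1n.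
by move=> l1; apply/andP; split; lra.
Qed.

Local Notation lower_spectrum :=
  [set b : R | eigenvalue (K_mx p) b /\ exists2 a, eigenvalue (K_mx p) a & b < a]%classic.

Lemma lower_spectrum_ub : ubound lower_spectrum top.
Proof.
have /andP[t0 t1] := top_bounds.
move=> b [eb [a ea ab]].
by case: (eigenvalue_le eb) (eigenvalue_le ea) => [b1|//] [a1|a1]; lra.
Qed.

Lemma spectral_gap_top : spectral_gap (K_mx p) = lambda_star R m.+3 <-> (0 < N)%N.
Proof.
have /andP[t0 t1] := top_bounds.
have -> : spectral_gap (K_mx p) = lambda_star R m.+3 <-> sup lower_spectrum = top.
  by rewrite /spectral_gap /second_largest_eigenvalue; split; lra.
rewrite -eigenvalue_top; split=> [sup_top|et].
  apply: contraT => net.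
  (* Without a genuine supremum [sup] takes the default value 0, whereas [top] is positive. *)
  have sup_ne : has_sup lower_spectrum.
    apply: contrapT => /sup_out; rewrite sup_top; lra.
  have q0 : (char_poly (K_mx p)).[top] != 0.
    by move: net; rewrite eigenvalue_root_char.
  (* If [top] is not a root, continuity keeps the characteristic polynomial nonzero nearby, while
     the supremum supplies eigenvalues arbitrarily close to [top]. *)
  have q_near := cvgr_neq0 _ (@continuous_horner R (char_poly (K_mx p)) top) q0.
  have [e /= e0 ball_top] := q_near _.
  have [b [eb eb'] lt_b] := sup_adherent e0 sup_ne.
  have := lower_spectrum_ub (conj eb eb') => b_top.
  have : ball top e b.
    by rewrite /ball /= ger0_norm; move: lt_b b_top; rewrite sup_top; lra.
  by move/ball_top; rewrite /= -/(root _ _) -eigenvalue_root_char eb.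
apply/eqP; rewrite eq_le; apply/andP; split.
  apply: ge_sup; last exact: lower_spectrum_ub.
  by exists top; split=> //; exists 1 => //; exact: eigenvalue1.
apply: ub_le_sup; first by exists top; exact: lower_spectrum_ub.
by split=> //; exists 1 => //; exact: eigenvalue1.
Qed.

End Multiplicity.

Theorem theorem1p8 (R : realType) (n : nat) (p : 'I_n -> 'I_n -> R)
    (hn : (3 <= n)%N) (hp : param_vector p) (hreg : regular p) :
  (spectral_gap (K_mx p) = lambda_star R n <-> (1 <= num_neutral p)%N) /\
  (let N := num_neutral p in
   let M := alg_mult (K_mx p) (1 - lambda_star R n) in
   (N <> (n - 2)%N /\ N <> n -> M = N) /\
   (N = (n - 2)%N \/ N = n -> M = (n - 1)%N)).
Proof.
case: n p hn hp hreg => [|[|[|m]]] // p _ hp hreg.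
split; first exact: spectral_gap_top.
have -> : (m.+3 - 2 = m.+1)%N by [].
have -> : (m.+3 - 1 = m.+2)%N by [].
rewrite /= alg_mult_top // card_free_labels; split.
  by case=> /eqP/negPf -> /eqP/negPf ->.
by case=> e; rewrite {1 2}e eqxx ?orbT.
Qed.
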